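(* If the ball $B^{2d}(R)\subset\mathbb C^d$ is covered by unitary planks, then the sum of the cross-section areas of the planks is at least $\pi R^2$.
   Context: $B^{2d}(R)\subset\mathbb C^d$ is the ball of radius $R$ centered at the origin. A unitary plank $P$ is a unitary image of $K\times\mathbb C^{d-1}\subset\mathbb C^d$ (that is, its image under a unitary transformation of $\mathbb C^d$), where $K\subseteq\mathbb C$ is measurable; the area of $K$ is called the cross-section area of $P$. *)

(* Defs.v *)
From HB Require Import structures.
From mathcomp Require Import all_boot all_order all_algebra.
From mathcomp Require Import all_classical all_reals all_analysis.
From mathcomp Require Import complex.

Set Implicit Arguments.
Unset Strict Implicit.
Unset Printing Implicit Defensive.

Import Order.TTheory GRing.Theory Num.Theory.
Import numFieldNormedType.Exports.

Local Open Scope classical_set_scope.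
Local Open Scope ring_scope.

Section ComplexPlane.
Variable R : realType.

Definition plane_of (K : set R[i]) :
    set (measurableTypeR R * measurableTypeR R) :=
  [set p | K (p.1 +i* p.2)%C].

(* Lebesgue (not only Borel) measurability, as Caratheodory measurability for
   the outer measure generated by planar Lebesgue measure. *)
Definition measurable_plane (K : set R[i]) : Prop :=
  (((@lebesgue_measure R \x @lebesgue_measure R)%E)^*)%mu.-cara.-measurable (plane_of K).

Definition area (K : set R[i]) : \bar R :=
  @completed_measure_extension _ _ R (@lebesgue_measure R \x @lebesgue_measure R)%E
    (plane_of K).

End ComplexPlane.

Section UnitaryPlanks.
Variables (R : realType) (n : nat).
Local Notation d := n.+1.

(* The library norm on matrices is the supremum norm, hence the explicit
   Euclidean norm of C^d = R^{2d}. *)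
Definition euclidean_norm (z : 'cV[R[i]]_d) : R :=
  Num.sqrt (\sum_(k < d) (complex.Re (z k 0) ^+ 2 + complex.Im (z k 0) ^+ 2)).

(* The open ball: a family covering the closed ball also covers the open one,
   so a covering theorem for the open ball contains the one for the closed ball. *)
Definition complex_ball (r : R) : set 'cV[R[i]]_d :=
  [set z | euclidean_norm z < r].

Record unitary_plank := UnitaryPlank {
  plank_unitary : 'M[R[i]]_d ;
  plank_section : set R[i] ;
  plank_unitaryP : plank_unitary \is unitarymx ;
  plank_sectionP : measurable_plane plank_section }.

Definition cylinder (K : set R[i]) : set 'cV[R[i]]_d :=
  [set z | K (z 0 0)].

Definition plank_set (P : unitary_plank) : set 'cV[R[i]]_d :=
  [set plank_unitary P *m z | z in cylinder (plank_section P)].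

Definition cross_section_area (P : unitary_plank) : \bar R :=
  area (plank_section P).

End UnitaryPlanks.

(* Main.v *)
Require Import Defs.
From HB Require Import structures.
From mathcomp Require Import all_boot all_order all_algebra.
From mathcomp Require Import all_classical all_reals all_analysis.
From mathcomp Require Import measurable_realfun complex.
From mathcomp Require Import ring lra.

(* Enlarge the sections to bounded open sets O_i, covering a slightly smaller ball of
   radius R' < R and of total area A < pi R'^2; by compactness finitely many are enough.
   Write l_i for the coordinate of C^d in which the i-th plank is O_i x C^(d-1), and let
     u(z) = sum_i int_(O_i) log |l_i(z) - w| dw,
   a plurisubharmonic function growing like A log |z|, whose Laplacian in the direction
   of the i-th section is at least 2 pi wherever l_i(z) is in O_i.  Choose c < pi / 2 with
   A < 2 c R'^2 and maximize u(z) - g(|z|^2) on C^d, where g(s) = c s for s <= R'^2 and g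
   continues as a logarithm with a C^1 gluing.  The maximum exists because g grows faster
   than u.  It cannot lie outside the ball, because u is subharmonic and g(|z|^2)
   harmonic on the complex line through 0 and the maximum.  Hence it lies in the ball,
   where the Laplacian of u in the direction of each section is at most 4 c < 2 pi, so
   the point is not covered.

   To avoid second derivatives of u, the logarithm is replaced by log (|w|^2 + e) / 2 and
   Laplacians by four-point differences. *)

Set Implicit Arguments.
Unset Strict Implicit.
Unset Printing Implicit Defensive.

Import Order.TTheory GRing.Theory Num.Theory.
Import numFieldNormedType.Exports.

Local Open Scope classical_set_scope.
Local Open Scope ring_scope.

(** * The smoothed logarithm *)

Section SmoothedLog.
Variable R : realType.
Implicit Types x y a b e : R.

Definition smoothed_log e x y : R := ln (x ^+ 2 + y ^+ 2 + e) / 2.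

(** Half the Laplacian of [smoothed_log e]; for every [e > 0] its integral over the plane is
    [pi]. *)
Definition density e x y : R := e / (x ^+ 2 + y ^+ 2 + e) ^+ 2.

(* To second order, the square of the length of h = a + i b times the Laplacian of U:
   the four points are at h, - h, i h and - i h. *)
Definition lap4 (U : R -> R -> R) x y a b : R :=
  U (x + a) (y + b) + U (x - a) (y - b) + U (x - b) (y + a) +
  U (x + b) (y - a) - 4 * U x y.

(** The bound [ln v <= v - 1] at [v = 1 / (1 + u)] gives [u / (1 + u) <= ln (1 + u)]; what remains
    is [0 <= u ^+ 2 * (1 + 2 * u)]. *)
Lemma ln_lower_quadratic (u : R) : - 2^-1 <= u -> u - 2 * u ^+ 2 <= ln (1 + u).
Proof.
move=> hu; have u1 : 0 < 1 + u by lra.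
apply: (@le_trans _ _ (1 - (1 + u)^-1)).
  have -> : 1 - (1 + u)^-1 = u / (1 + u) by field; lra.
  rewrite ler_pdivlMr//; have := sqr_ge0 u; nra.
rewrite lerBlDl -lerBlDr.
have : ln (1 + ((1 + u)^-1 - 1)) <= (1 + u)^-1 - 1.
  by apply: le_ln1Dx; have := invr_gt0 (1 + u); rewrite u1; lra.
by rewrite addrC subrK lnV ?posrE//; lra.
Qed.

(** The product of the two shifted arguments is at least [D ^+ 2 * (1 + u)], and Cauchy-Schwarz in
    the form [p ^+ 2 <= D * al] keeps [u] within [4 * (al / e) <= 1 / 2] of 0, so that the quadratic
    lower bound applies to [ln (1 + u)]. *)
Lemma lnD_sym_lower x y a b e : 0 < e -> 8 * (a ^+ 2 + b ^+ 2) <= e ->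
  (2 * (a ^+ 2 + b ^+ 2) * (x ^+ 2 + y ^+ 2 + e) - 4 * (x * a + y * b) ^+ 2)
    / (x ^+ 2 + y ^+ 2 + e) ^+ 2 - 32 / e ^+ 2 * (a ^+ 2 + b ^+ 2) ^+ 2
  <= ln ((x + a) ^+ 2 + (y + b) ^+ 2 + e) + ln ((x - a) ^+ 2 + (y - b) ^+ 2 + e)
     - 2 * ln (x ^+ 2 + y ^+ 2 + e).
Proof.
move=> e0; set al := a ^+ 2 + b ^+ 2 => hal.
set D := x ^+ 2 + y ^+ 2 + e; set p := x * a + y * b.
have al0 : 0 <= al by rewrite addr_ge0 ?sqr_ge0.
have eD : e <= D by rewrite lerDr addr_ge0 ?sqr_ge0.
have D0 : 0 < D by lra.
set u := (_ / D ^+ 2).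
have pD : p ^+ 2 <= D * al.
  have -> : D * al = p ^+ 2 + (x * b - y * a) ^+ 2 + e * al by rewrite /D /p /al; ring.
  by rewrite -addrA lerDl addr_ge0 ?sqr_ge0// mulr_ge0// ltW.
have D2 : 0 < D ^+ 2 by rewrite exprn_gt0.
have [q qE] : exists q, q = al / e by exists (al / e).
have alE : al = q * e by rewrite qE divfK// gt_eqF.
have q0 : 0 <= q by rewrite qE divr_ge0// ltW.
have qeD : q * e * D <= q * D ^+ 2 by rewrite expr2 mulrA ler_pM2r// ler_wpM2l.
have qeD0 : 0 <= q * e * D by rewrite !mulr_ge0// ltW.
have u1 : u <= 4 * (al / e).
  rewrite -qE /u ler_pdivrMr// alE; have := sqr_ge0 p; lra.
have u2 : - (4 * (al / e)) <= u.
  rewrite -qE /u ler_pdivlMr// alE; rewrite alE in pD; lra.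
have ale : 4 * (al / e) <= 2^-1 by rewrite mulrA ler_pdivrMr//; lra.
have uu : u ^+ 2 <= 16 * (al / e) ^+ 2.
  have -> : 16 * (al / e) ^+ 2 = (4 * (al / e)) ^+ 2 by ring.
  by rewrite -[u ^+ 2]real_normK ?num_real// ler_pXn2r ?nnegrE ?ler_norml ?u2// mulr_ge0// divr_ge0// ltW.
have P1 : 0 < (x + a) ^+ 2 + (y + b) ^+ 2 + e.
  by rewrite ltr_wpDl// addr_ge0 ?sqr_ge0.
have P2 : 0 < (x - a) ^+ 2 + (y - b) ^+ 2 + e.
  by rewrite ltr_wpDl// addr_ge0 ?sqr_ge0.
apply: (@le_trans _ _ (ln (1 + u))).
  apply: le_trans (ln_lower_quadratic _); last by lra.
  have -> : 32 / e ^+ 2 * al ^+ 2 = 2 * (16 * (al / e) ^+ 2) by field; lra.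
  lra.
have -> : 2 * ln D = ln (D ^+ 2) by rewrite lnXn// mulr_natl.
rewrite -lnM ?posrE// -ln_div ?posrE ?mulr_gt0//.
have u10 : 0 < 1 + u by lra.
rewrite ler_ln ?posrE ?divr_gt0 ?mulr_gt0//.
rewrite ler_pdivlMr// mulrDl mul1r /u divfK ?gt_eqF//.
have -> : ((x + a) ^+ 2 + (y + b) ^+ 2 + e) * ((x - a) ^+ 2 + (y - b) ^+ 2 + e) =
   D ^+ 2 + (2 * al * D - 4 * p ^+ 2) + al ^+ 2.
  by rewrite /D /al /p; ring.
by rewrite lerDl sqr_ge0.
Qed.

(** The symmetric bound is added for the steps [(a, b)] and [(- b, a)]. The squares of the two
    scalar products with [(x, y)] sum to [(a ^+ 2 + b ^+ 2) * (D - e)], so the terms linear in [D]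
    cancel and only the multiple of [e] survives. *)
Lemma lap4_smoothed_log x y a b e : 0 < e -> 8 * (a ^+ 2 + b ^+ 2) <= e ->
  2 * (a ^+ 2 + b ^+ 2) * density e x y - 32 / e ^+ 2 * (a ^+ 2 + b ^+ 2) ^+ 2
  <= lap4 (smoothed_log e) x y a b.
Proof.
move=> e0 hab.
have h1 := lnD_sym_lower x y e0 hab.
have hba : 8 * ((- b) ^+ 2 + a ^+ 2) <= e by rewrite sqrrN addrC.
have h2 := lnD_sym_lower x y e0 hba.
have {h1 h2} := lerD h1 h2.
rewrite /lap4 /smoothed_log !opprK sqrrN [b ^+ 2 + a ^+ 2]addrC.
set D := x ^+ 2 + y ^+ 2 + e.
have D0 : 0 < D by rewrite ltr_wpDl// addr_ge0 ?sqr_ge0.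
set l := (X in X <= _); move=> hl.
rewrite -(ler_pM2l (ltr0n R 2)).
apply: le_trans (_ : _ <= l) _; last by apply: le_trans hl _; lra.
rewrite le_eqVlt; apply/orP; left; apply/eqP.
rewrite /l /density -/D.
have -> : (2 * (a ^+ 2 + b ^+ 2) * D - 4 * (x * - b + y * a) ^+ 2) =
  (2 * (a ^+ 2 + b ^+ 2) * D - 4 * ((a ^+ 2 + b ^+ 2) * (D - e) - (x * a + y * b) ^+ 2)).
  by rewrite /D; ring.
by field; rewrite !gt_eqF.
Qed.

Lemma density_gt0 e x y : 0 < e -> 0 < density e x y.
Proof. by move=> e0; rewrite divr_gt0// exprn_gt0// ltr_wpDl// addr_ge0 ?sqr_ge0. Qed.

End SmoothedLog.

(** * The area of a disc *)

Section DiscArea.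
Variable R : realType.

Local Notation mu := (@lebesgue_measure R \x @lebesgue_measure R)%E.

(* [s] is the square of the radius. *)
Definition disc (x y s : R) : set (measurableTypeR R * measurableTypeR R) :=
  [set w | (x - w.1) ^+ 2 + (y - w.2) ^+ 2 < s].

Lemma measurable_sqdist (x y : R) :
  measurable_fun setT (fun w : measurableTypeR R * measurableTypeR R =>
    (x - w.1) ^+ 2 + (y - w.2) ^+ 2).
Proof.
by apply: measurable_funD; apply: measurable_funX; apply: measurable_funB.
Qed.

Lemma measurable_disc x y s : measurable (disc x y s).
Proof.
rewrite [disc x y s](_ : _ = setT `&` (fun w : measurableTypeR R * measurableTypeR R =>
    (x - w.1) ^+ 2 + (y - w.2) ^+ 2) @^-1` `]-oo, s[%classic).
  by apply: measurable_sqdist => //; exact: measurable_itv.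
by rewrite setTI; apply/seteqP; split=> w /=; rewrite /disc/= in_itv.
Qed.

(** The square root of a negative number is 0 by convention, so the formula also covers the lines
    that miss the disc. *)
Lemma lebesgue_measure_xsection_disc x y s w :
  lebesgue_measure (xsection (disc x y s) w) = (2 * Num.sqrt (s - (x - w) ^+ 2))%:E.
Proof.
set h := Num.sqrt _.
have h0 : 0 <= h by exact: sqrtr_ge0.
have -> : xsection (disc x y s) w = `]y - h, y + h[%classic.
  apply/seteqP; split=> z; rewrite /xsection/= inE /disc/= in_itv/=.
    move=> hz; have hh : h ^+ 2 = s - (x - w) ^+ 2.
      by rewrite sqr_sqrtr// subr_ge0 ltW// (le_lt_trans _ hz)// lerDl sqr_ge0.
    have : `|y - z| < h.
      rewrite -(@ltr_pXn2r _ 2)// ?nnegrE// real_normK ?num_real// hh; lra.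
    by rewrite ltr_distlC.
  move=> hz; have : `|y - z| < h by rewrite ltr_distlC.
  have [s0|s0] := leP 0 (s - (x - w) ^+ 2); last first.
    by rewrite /h ler0_sqrtr ?(ltW s0)// normr_lt0.
  rewrite -(@ltr_pXn2r _ 2)// ?nnegrE// real_normK ?num_real// /h sqr_sqrtr//; lra.
rewrite lebesgue_measure_itv/= lte_fin.
have [yh|yh] := ltP (y - h) (y + h); first by rewrite -EFinB; congr (_%:E); ring.
have -> : h = 0 by lra.
by rewrite mulr0.
Qed.

(** The first term is [s] times the arcsine of [(w - x) / Num.sqrt s] in half-angle form, [arcsin t
    = 2 arctan (t / (1 + sqrt (1 - t^2)))]; its denominator stays positive up to the ends of the
    interval. *)
Lemma is_derive_circle_primitive (x s w : R) : 0 < s -> (x - w) ^+ 2 < s ->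
  is_derive w 1 (fun w => 2 * s * atan ((w - x) / (Num.sqrt s + Num.sqrt (s - (x - w) ^+ 2)))
     + (w - x) * Num.sqrt (s - (x - w) ^+ 2)) (2 * Num.sqrt (s - (x - w) ^+ 2)).
Proof.
move=> s0 hw.
pose W (w : R) := Num.sqrt (s - (x - w) ^+ 2).
have dW : is_derive w 1 W (- ((w - x) / W w)).
  have d1 : is_derive w 1 (fun w : R => s - (x - w) ^+ 2) (2 * (x - w)).
    by apply: is_derive_eq; rewrite /GRing.scale/=; ring.
  have d2 : is_derive (s - (x - w) ^+ 2) 1 Num.sqrt (2 * W w)^-1.
    by apply: is_derive1_sqrt; rewrite subr_gt0.
  apply: (is_derive_eq (@is_derive1_comp _ Num.sqrt _ w _ _ d2 d1)).
  have : 0 < W w by rewrite sqrtr_gt0 subr_gt0.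
  by move=> Ww; field; lra.
have W0 : 0 < W w by rewrite sqrtr_gt0 subr_gt0.
have rho0 : 0 < Num.sqrt s by rewrite sqrtr_gt0.
have WE : W w ^+ 2 = s - (x - w) ^+ 2 by rewrite sqr_sqrtr// subr_ge0 ltW.
have sE : Num.sqrt s ^+ 2 = s by rewrite sqr_sqrtr// ltW.
have dD : is_derive w 1 (fun w => (Num.sqrt s + W w)^-1)
   (- (Num.sqrt s + W w) ^- 2 *: (0 + - ((w - x) / W w))).
  by apply: is_deriveV; lra.
have dq : is_derive w 1 (fun w => (w - x) / (Num.sqrt s + W w)) ((W w * (Num.sqrt s + W w))^-1 * Num.sqrt s).
  apply: is_derive_eq; rewrite /GRing.scale/=.
  have t2 : (w - x) ^+ 2 = Num.sqrt s ^+ 2 - W w ^+ 2 by rewrite WE sE; ring.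
  transitivity ( ((w - x) ^+ 2 + W w * (Num.sqrt s + W w)) / (W w * (Num.sqrt s + W w) ^+ 2)).
    by field; lra.
  by rewrite t2; field; lra.
have dat := @is_derive1_comp _ atan _ w _ _ (is_derive1_atan _) dq.
apply: is_derive_eq.
rewrite -/(W w) /GRing.scale/=.
have t2 : (w - x) ^+ 2 = Num.sqrt s ^+ 2 - W w ^+ 2 by rewrite WE sE; ring.
have -> : 1 + ((w - x) / (Num.sqrt s + W w)) ^+ 2 = 2 * Num.sqrt s / (Num.sqrt s + W w).
  transitivity (((w - x) ^+ 2 + (Num.sqrt s + W w) ^+ 2) / (Num.sqrt s + W w) ^+ 2).
    by field; lra.
  by rewrite t2; field; lra.
have -> : (w - x) * - ((w - x) / W w) = - ((w - x) ^+ 2 / W w) by field; lra.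
by rewrite t2 -{1}sE; field; lra.
Qed.

Lemma disc_area x y s : 0 <= s -> mu (disc x y s) = (pi * s)%:E.
Proof.
rewrite le_eqVlt => /predU1P[<-|s0].
  rewrite mulr0 (_ : disc x y 0 = set0) ?measure0//.
  by apply/seteqP; split=> // w /=; rewrite /disc/= ltNge addr_ge0 ?sqr_ge0.
rewrite /product_measure1 /=.
under eq_integral do rewrite /= lebesgue_measure_xsection_disc.
have rho0 : 0 < Num.sqrt s by rewrite sqrtr_gt0.
have sE : Num.sqrt s ^+ 2 = s by rewrite sqr_sqrtr// ltW.
pose a := x - Num.sqrt s; pose b := x + Num.sqrt s.
transitivity (\int[lebesgue_measure]_(w in `[a, b]) (2 * Num.sqrt (s - (x - w) ^+ 2))%:E)%E.
  rewrite [RHS]integral_mkcond; apply: eq_integral => w _.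
  rewrite patchE; case: ifPn => //; rewrite notin_setE/= in_itv/= /a /b => /negP.
  rewrite -ler_distlC => hw; rewrite ler0_sqrtr ?mulr0// subr_le0.
  rewrite -sE -[(x - w) ^+ 2]real_normK ?num_real// ler_pXn2r ?nnegrE ?(ltW rho0)//.
  by rewrite ltW// ltNge.
pose W (w : R) := Num.sqrt (s - (x - w) ^+ 2).
have cW : continuous W.
  move=> w; apply: (@continuous_comp _ _ _ (fun w : R => s - (x - w) ^+ 2) Num.sqrt); last exact: sqrt_continuous.
  apply: cvgB; first exact: cvg_cst.
  apply: (@continuous_comp _ _ _ (fun w : R => x - w) (fun u => u ^+ 2)); last exact: exprn_continuous.
  by apply: cvgB; [exact: cvg_cst|exact: cvg_id].
pose F w := 2 * s * atan ((w - x) / (Num.sqrt s + W w)) + (w - x) * W w.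
have cF : continuous F.
  move=> w; apply: cvgD.
    apply: cvgM; first exact: cvg_cst.
    apply: (@continuous_comp _ _ _ (fun w : R => (w - x) / (Num.sqrt s + W w)) atan); last exact: continuous_atan.
    apply: cvgM; first by apply: cvgB; [exact: cvg_id|exact: cvg_cst].
    apply: cvgV; first by have := sqrtr_ge0 (s - (x - w) ^+ 2); rewrite /W; lra.
    by apply: cvgD; [exact: cvg_cst|exact: cW].
  by apply: cvgM; [apply: cvgB; [exact: cvg_id|exact: cvg_cst]|exact: cW].
have din w : w \in `]a, b[ -> (x - w) ^+ 2 < s.
  rewrite in_itv/= -ltr_distlC => hw.
  by rewrite -sE -[(x - w) ^+ 2]real_normK ?num_real// ltr_pXn2r ?nnegrE ?(ltW rho0).
have ab : a < b by rewrite /a /b; lra.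
rewrite (@continuous_FTC2 _ _ F)//.
- have Wa : W a = 0 by rewrite /W /a subKr sE subrr sqrtr0.
  have Wb : W b = 0 by rewrite /W /b opprD addrA subrr sub0r sqrrN sE subrr sqrtr0.
  (* At the two ends [W] vanishes and the arctangent takes the values [pi / 4] and [- pi / 4]. *)
  rewrite -EFinB; congr (_%:E); rewrite /F Wa Wb !mulr0 !addr0.
  have -> : (b - x) / Num.sqrt s = 1 by rewrite /b; field; lra.
  have -> : (a - x) / Num.sqrt s = -1 by rewrite /a; field; lra.
  by rewrite atanN atan1; field.
- apply: continuous_subspaceT => w; apply: cvgM; [exact: cvg_cst|exact: cW].
- split; last 2 first.
  + by apply: cvg_at_right_filter; exact: cF.
  + by apply: cvg_at_left_filter; exact: cF.
  + by move=> w /din hw; have [] := is_derive_circle_primitive s0 hw.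
- by move=> w /din hw; rewrite derive1E; have [_] := is_derive_circle_primitive s0 hw.
Qed.

End DiscArea.

(** * Outer regularity of planar Lebesgue measure *)

Section OuterRegularity.
Variable R : realType.

Local Notation T := (measurableTypeR R * measurableTypeR R)%type.

(** Openness for the Euclidean distance, in terms of discs because the lower bound of the smoothed
    mass at a point asks for a disc around it. *)
Definition disc_open (O : set T) :=
  forall p, O p -> exists2 s : R, 0 < s & disc p.1 p.2 s `<=` O.

Lemma disc_openI A B : disc_open A -> disc_open B -> disc_open (A `&` B).
Proof.
move=> oA oB p [/oA[s s0 sA] /oB[t t0 tB]]; exists (Num.min s t).
  by rewrite lt_min s0.
move=> w; rewrite /disc/= lt_min => /andP[ws wt].
by split; [exact: sA | exact: tB].
Qed.

Lemma disc_open_bigcup (F : nat -> set T) :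
  (forall n, disc_open (F n)) -> disc_open (\bigcup_n F n).
Proof.
move=> oF p [n _ /oF[s s0 sF]]; exists s => // w /sF ?.
by exists n.
Qed.

Lemma disc_open_setC_bigcup (F : nat -> set T) N :
  (forall n, disc_open (~` F n)) -> disc_open (~` \bigcup_(n in `I_N) F n).
Proof.
move=> oF; elim: N => [|N IH].
  by rewrite II0 bigcup_set0 setC0 => p _; exists 1.
by rewrite IIS bigcup_setU bigcup_set1 setCU; exact: disc_openI.
Qed.

Lemma disc_open_disc (r : R) : disc_open (disc 0 0 r).
Proof.
move=> p; rewrite /disc/= !sub0r !sqrrN => hp.
set n := p.1 ^+ 2 + p.2 ^+ 2 in hp.
have n0 : 0 <= n by rewrite addr_ge0 ?sqr_ge0.
have r0 : 0 < r by exact: le_lt_trans hp.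
have sqlt : Num.sqrt n < Num.sqrt r by rewrite ltr_sqrt.
exists ((Num.sqrt r - Num.sqrt n) ^+ 2); first by rewrite exprn_gt0// subr_gt0.
move=> w /=; rewrite !sub0r !sqrrN.
set m := _ + _ => hm.
have m0 : 0 <= m by rewrite addr_ge0 ?sqr_ge0.
set a := Num.sqrt n in sqlt hm *; set b := Num.sqrt r in sqlt hm *.
have aE : a ^+ 2 = n by rewrite sqr_sqrtr.
have bE : b ^+ 2 = r by rewrite sqr_sqrtr// ltW.
have a0 : 0 <= a by exact: sqrtr_ge0.
have [c [c0 cE]] : exists c, 0 <= c /\ c ^+ 2 = m by exists (Num.sqrt m); rewrite sqrtr_ge0 sqr_sqrtr.
have cb : c < b - a by rewrite -(@ltr_pXn2r _ 2)// ?nnegrE ?cE//; lra.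
have [k [k0 kE]] : exists k, 0 <= k /\ k ^+ 2 = w.1 ^+ 2 + w.2 ^+ 2.
  by exists (Num.sqrt (w.1 ^+ 2 + w.2 ^+ 2)); rewrite sqrtr_ge0 sqr_sqrtr// addr_ge0 ?sqr_ge0.
rewrite -kE -bE ltr_pXn2r ?nnegrE//; last lra.
suff : k <= a + c by lra.
rewrite -(@ler_pXn2r _ 2)// ?nnegrE//; last lra.
rewrite kE sqrrD aE cE /n /m.
set X := p.1 * (w.1 - p.1) + p.2 * (w.2 - p.2).
suff : X <= a * c by rewrite /X => ?; nra.
apply: le_trans (ler_norm _) _.
rewrite -(@ler_pXn2r _ 2)// ?nnegrE ?mulr_ge0// real_normK ?num_real//.
rewrite exprMn aE cE /n /m /X.
(* Lagrange's identity: this square is the defect in the Cauchy-Schwarz inequality for [p] and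
   [w - p]. *)
have := sqr_ge0 (p.1 * (w.2 - p.2) - p.2 * (w.1 - p.1)); nra.
Qed.

Section Finite.
Variable nu : {measure set T -> \bar R}.
Hypothesis nu_fin : (nu setT < +oo)%E.

Let nu_finite A : measurable A -> (nu A < +oo)%E.
Proof.
move=> mA; apply: le_lt_trans nu_fin.
by apply: le_measure => //; rewrite inE.
Qed.

(* Unlike outer regularity alone, this two-sided form is stable under complement. *)
Definition disc_regular (B : set T) := measurable B /\
  forall e : R, 0 < e -> exists F O : set T,
    [/\ measurable F, measurable O, disc_open (~` F), disc_open O &
        [/\ F `<=` B, B `<=` O & (nu (O `\` F) <= e%:E)%E]].

(** Continuity from above, available because [nu] is finite; it lets a countable construction stop
    at a finite stage. *)
Lemma nonincreasing_measure_lt (D : nat -> set T) (e : R) :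
  (forall n, measurable (D n)) -> {homo D : n m / (n <= m)%N >-> (m <= n)%O} ->
  (nu (\bigcap_n D n) < e%:E)%E -> exists n, (nu (D n) <= e%:E)%E.
Proof.
move=> mD dD De.
have mI : measurable (\bigcap_n D n) by exact: bigcapT_measurable.
have cv := nonincreasing_cvg_mu (nu_finite (mD 0%N)) mD mI dD.
have [N _ HN] := cv _ (open_ereal_lt' De).
by exists N; apply/ltW/(HN N) => /=.
Qed.

(** Complementation exchanges the closed and the open set. For a countable union all the open sets
    are kept, but only finitely many closed ones, since an infinite union of closed sets may fail to
    be closed. With all closed sets the error would be at most [e / 2]; by continuity from above
    finitely many already give at most [e]. *)
Lemma sigma_algebra_disc_regular : sigma_algebra setT disc_regular.
Proof.
split.
- split=> // e e0; exists set0, set0; split=> //.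
  by rewrite setC0 => p _; exists 1.
  by split=> //; rewrite setD0 measure0 lee_fin ltW.
- move=> A [mA rA]; rewrite setTD; split; first exact: measurableC.
  move=> e /rA[F [Q [mF mQ oF oQ [FA AQ h]]]]; exists (~` Q), (~` F); split.
  + exact: measurableC.
  + exact: measurableC.
  + by rewrite setCK.
  + by [].
  + split; [exact: subsetC|exact: subsetC|].
    by rewrite setDE setCK setIC -setDE.
- move=> A rA; split; first by apply: bigcupT_measurable => n; have [] := rA n.
  move=> e e0.
  have e20 : 0 < e / 2 by rewrite divr_gt0.
  have /choice[FO HFO] n : exists FO : set T * set T,
    [/\ measurable FO.1, measurable FO.2, disc_open (~` FO.1), disc_open FO.2 &
        [/\ FO.1 `<=` A n, A n `<=` FO.2 & (nu (FO.2 `\` FO.1) <= (e / 2 / (2 ^ n.+1)%:R)%:E)%E]].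
    have [_] := rA n; move=> /(_ (e / 2 / (2 ^ n.+1)%:R)).
    case; first by rewrite !divr_gt0// ltr0n expn_gt0.
    by move=> F [Q H]; exists (F, Q).
  pose O := \bigcup_n (FO n).2.
  pose D N := O `\` \bigcup_(n in `I_N) (FO n).1.
  have mO : measurable O by apply: bigcupT_measurable => n; have [] := HFO n.
  have mD N : measurable (D N).
    by apply: measurableD => //; apply: bigcup_measurable => n _; have [] := HFO n.
  have dD : {homo D : n m / (n <= m)%N >-> (m <= n)%O}.
    move=> n m nm; apply/subsetPset => w [Ow Fw]; split=> //; case=> k /= kn Fk.
    by apply: Fw; exists k => //=; exact: leq_trans kn nm.
  have [|N HN] := nonincreasing_measure_lt (e := e) mD dD.
    apply: (@le_lt_trans _ _ (e / 2)%:E); last by rewrite lte_fin; lra.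
    have sub : \bigcap_n D n `<=` \bigcup_n ((FO n).2 `\` (FO n).1).
      move=> w Dw; have [[n _ On] _] := Dw 0%N I.
      exists n => //; split=> // Fn; have [_] := Dw n.+1 I; apply.
      by exists n => /=.
    apply: le_trans (measure_sigma_subadditive _ _ _ sub) _.
    + by move=> n; apply: measurableD; have [] := HFO n.
    + exact: bigcapT_measurable.
    apply: le_trans (epsilon_trick0 xpredT (ltW e20)) => //.
    by apply: lee_nneseries => // n _; have [_ _ _ _ []] := HFO n.
  exists (\bigcup_(n in `I_N) (FO n).1), O; split=> //.
  + by apply: bigcup_measurable => n _; have [] := HFO n.
  + by apply: disc_open_setC_bigcup => n; have [] := HFO n.
  + by apply: disc_open_bigcup => n; have [] := HFO n.
  + split=> //.
      by move=> w [n _ Fn]; exists n => //; have [_ _ _ _ [+ _ _]] := HFO n; apply.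
    by move=> w [n _ Fn]; exists n => //; have [_ _ _ _ [_ + _]] := HFO n; apply.
Qed.

(** The sets with regular preimage form a sigma-algebra, and the open rays generate the Borel sets
    of the line. *)
Lemma disc_regular_preimage (f : T -> measurableTypeR R) :
  (forall t : R, disc_regular (f @^-1` [set x | t < x])) ->
  forall A, measurable A -> disc_regular (f @^-1` A).
Proof.
move=> hf A.
have [r0 rC rU] := sigma_algebra_disc_regular.
have : @measurable _ (measurableTypeR R) `<=` [set A | disc_regular (f @^-1` A)].
  rewrite [X in X `<=` _](_ : _ = <<s @RGenOInfty.G R >>); last exact: RGenOInfty.measurableE.
  apply: smallest_sub.
    split.
    - by rewrite /= preimage_set0.
    - by move=> B rB; rewrite /= setTD preimage_setC -setTD; exact: rC.
    - by move=> B rB; rewrite /= preimage_bigcup; exact: rU.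
  move=> _ [t ->] /=; rewrite (_ : _ @^-1` _ = f @^-1` [set x | t < x]); first exact: hf.
  by apply/seteqP; split=> w /=; rewrite in_itv/= andbT.
exact.
Qed.

(** As [f] is 1-Lipschitz, its strict superlevel set is open; it is the increasing union of the
    closed sets where [f] is at least [t + 1 / (n + 1)]. *)
Lemma disc_regular_halfplane (f : T -> measurableTypeR R) t :
  measurable_fun setT f -> (forall p q : T, (f p - f q) ^+ 2 <= (p.1 - q.1) ^+ 2 + (p.2 - q.2) ^+ 2) ->
  disc_regular (f @^-1` [set x | t < x]).
Proof.
move=> mf lf.
have mset (Q : set R) : measurable Q -> measurable (f @^-1` Q).
  by move=> mQ; rewrite -[X in measurable X]setTI; exact: mf.
have mO s : measurable (f @^-1` [set x : R | s < x]).
  apply: mset; rewrite (_ : [set _ | _] = `]s, +oo[%classic); first exact: measurable_itv.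
  by apply/seteqP; split=> x /=; rewrite in_itv/= andbT.
have mF s : measurable (f @^-1` [set x : R | s <= x]).
  apply: mset; rewrite (_ : [set _ | _] = `[s, +oo[%classic); first exact: measurable_itv.
  by apply/seteqP; split=> x /=; rewrite in_itv/= andbT.
split=> // e e0.
pose F n := f @^-1` [set x : R | t + n.+1%:R^-1 <= x].
pose D n := f @^-1` [set x : R | t < x] `\` F n.
have dD : {homo D : n m / (n <= m)%N >-> (m <= n)%O}.
  move=> n m nm; apply/subsetPset => w [Ow Fw]; split=> //; apply: contra_not Fw.
  apply: le_trans; rewrite lerD2l lef_pV2 ?posrE// ler_nat//.
have [|||n Hn] := @nonincreasing_measure_lt D e => //.
- by move=> n; apply: measurableD; [exact: mO|exact: mF].
- rewrite (_ : \bigcap_n D n = set0) ?measure0 ?lte_fin//.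
  apply/seteqP; split=> // w Dw; have [/= tw _] := Dw 0%N I.
  have [n nw] := ltr_add_invr tw.
  have [_] := Dw n I; apply.
  exact: ltW.
exists (F n), (f @^-1` [set x | t < x]); split=> //.
- exact: mF.
- move=> p /negP; rewrite -ltNge => hp; exists ((t + n.+1%:R^-1 - f p) ^+ 2).
    by rewrite exprn_gt0// subr_gt0.
  move=> w hw /=; apply/negP; rewrite -ltNge.
  have := le_lt_trans (lf _ _) hw => h.
  have : `|f p - f w| < t + n.+1%:R^-1 - f p.
    rewrite -(@ltr_pXn2r _ 2)// ?nnegrE ?subr_ge0 ?(ltW hp)// real_normK ?num_real//.
  rewrite ltr_norml => /andP[+ _].
  by rewrite opprB ltrD2l ltrN2.
- move=> p /= hp; exists ((f p - t) ^+ 2).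
    by rewrite exprn_gt0// subr_gt0.
  move=> w hw /=.
  have := le_lt_trans (lf _ _) hw => h.
  have : `|f p - f w| < f p - t.
    rewrite -(@ltr_pXn2r _ 2)// ?nnegrE ?subr_ge0 ?(ltW hp)// real_normK ?num_real//.
  rewrite ltr_norml => /andP[_].
  by rewrite ltrD2l ltrN2.
- split=> // w /=; apply: lt_le_trans; rewrite ltrDl invr_gt0//.
Qed.

(** The product sigma-algebra is generated by the preimages under the two projections, which are
    1-Lipschitz. *)
Lemma measurable_disc_regular B : measurable B -> disc_regular B.
Proof.
apply: smallest_sub; first exact: sigma_algebra_disc_regular.
move=> _ [] [A mA <-]; rewrite setTI.
  apply: (disc_regular_preimage (f := fst)) => // t; apply: disc_regular_halfplane => //.
  by move=> p q; rewrite lerDl sqr_ge0.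
apply: (disc_regular_preimage (f := snd)) => // t; apply: disc_regular_halfplane => //.
by move=> p q; rewrite lerDr sqr_ge0.
Qed.

End Finite.
End OuterRegularity.

(** * Open neighbourhoods of almost the same area *)

Section AreaCover.
Variable R : realType.

Local Notation mu := (@lebesgue_measure R \x @lebesgue_measure R)%E.

Lemma area_disc_open_cover (K : set R[i]) (s e : R) : 0 <= s -> 0 < e ->
  (area K < +oo)%E -> exists O : set (measurableTypeR R * measurableTypeR R),
    [/\ measurable O, disc_open O, plane_of K `&` disc 0 0 s `<=` O,
        O `<=` disc 0 0 s & (mu O <= area K + e%:E)%E].
Proof.
move=> s0 e0 Kfin.
have K0 : (0 <= area K)%E by exact: mu_ext_ge0.
have aK : area K \is a fin_num by rewrite ge0_fin_numE.
have e20 : 0 < e / 2 by rewrite divr_gt0.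
(* Half of [e] pays for a countable measurable cover nearly attaining the infimum that defines
   [area], the other half for enlarging this cover to an open set. *)
have : (area K < area K + (e / 2)%:E)%E by rewrite lteDl ?lte_fin.
move=> /ereal_inf_lt[_ [F [mF KF] <-] hF].
pose D := disc (R := R) 0 0 s.
have mD : measurable D by exact: measurable_disc.
(* Regularity was obtained for finite measures, hence the restriction to the disc. *)
pose nu := [the measure _ _ of mrestr mu mD].
have nufin : (nu setT < +oo)%E.
  by rewrite /nu /= /mrestr setTI disc_area// ltry.
have mB : measurable (\bigcup_n F n `&` D).
  by apply: measurableI => //; exact: bigcupT_measurable.
have [_ /(_ _ e20)] := measurable_disc_regular nufin mB.
move=> [C [Q [mC mQ oC oQ [CB BQ h]]]]; exists (Q `&` D); split.
- exact: measurableI.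
- by apply: disc_openI => //; exact: disc_open_disc.
- by move=> w [Kw Dw]; split=> //; apply: BQ; split=> //; exact: KF.
- exact: subIsetr.
- have sub : Q `&` D `<=` (\bigcup_n F n `&` D) `|` ((Q `\` C) `&` D).
    move=> w [Qw Dw]; have [Cw|Cw] := pselect (C w); last by right.
    by left; exact: CB.
  apply: (@le_trans _ _ (mu (\bigcup_n F n `&` D) + mu ((Q `\` C) `&` D))%E).
    apply: le_trans (measureU2 _ _ _) => //; last by apply: measurableI => //; exact: measurableD.
    apply: le_measure => //; rewrite inE; first exact: measurableI.
    by apply: measurableU => //; apply: measurableI => //; exact: measurableD.
  rewrite [leRHS](_ : _ = (area K + (e / 2)%:E) + (e / 2)%:E)%E; last first.
    by rewrite -addeA -EFinD -splitr.
  apply: leeD; last exact: h.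
  apply: le_trans (ltW hF); apply: (@le_trans _ _ (mu (\bigcup_n F n))).
    by apply: le_measure; rewrite ?inE//; exact: bigcupT_measurable.
  by apply: measure_sigma_subadditive => //; exact: bigcupT_measurable.
Qed.

End AreaCover.

(** * Smoothed logarithmic potentials *)

Section LogPotential.
Variable R : realType.

Local Notation T := (measurableTypeR R * measurableTypeR R)%type.

Variables (mu : {measure set T -> \bar R}) (O : set T) (W e : R).
Hypotheses (mO : measurable O) (mu_fin : (mu O < +oo)%E) (OW : O `<=` disc 0 0 W)
  (e0 : 0 < e).

Definition potential x y : R := \int[mu]_(w in O) smoothed_log e (x - w.1) (y - w.2).

(** Half the Laplacian of [potential]. For planar Lebesgue measure and small [e] it is close to [pi]
    at interior points of [O]. *)
Definition smoothed_mass x y : R := \int[mu]_(w in O) density e (x - w.1) (y - w.2).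

Let Dgt0 x y : 0 < x ^+ 2 + y ^+ 2 + e.
Proof. by rewrite ltr_wpDl// addr_ge0 ?sqr_ge0. Qed.

Let le_sqdist x y w : O w ->
  (x - w.1) ^+ 2 + (y - w.2) ^+ 2 + e <= (2 + 2 * `|W| + e) * (1 + x ^+ 2 + y ^+ 2).
Proof.
move=> /OW; rewrite /disc/= !sub0r !sqrrN => hw.
have := ler_norm W; have := sqr_ge0 (x + w.1); have := sqr_ge0 (y + w.2).
have := sqr_ge0 x; have := sqr_ge0 y; have := normr_ge0 W => W0 y0 x0.
have : 0 <= `|W| * (x ^+ 2 + y ^+ 2) by rewrite mulr_ge0// addr_ge0.
have : 0 <= e * (x ^+ 2 + y ^+ 2) by rewrite mulr_ge0// ?addr_ge0// ltW.
lra.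
Qed.

Lemma bounded_le_integrable (g : T -> R) (M : R) :
  measurable_fun setT g -> (forall w, O w -> `|g w| <= M) -> mu.-integrable O (EFin \o g).
Proof.
move=> mg gM; apply: measurable_bounded_integrable => //; first exact: measurable_funTS.
by exists M; split; [exact: num_real|move=> N MN w Ow; exact: le_trans (gM _ Ow) (ltW MN)].
Qed.

Lemma measurable_smoothed_log x y : measurable_fun setT (fun w : T => smoothed_log e (x - w.1) (y - w.2)).
Proof.
apply: measurable_funM => //; apply: measurableT_comp => //.
by apply: measurable_funD => //; exact: measurable_sqdist.
Qed.

Lemma measurable_density x y : measurable_fun setT (fun w : T => density e (x - w.1) (y - w.2)).
Proof.
(* The density is [e] times the exponential of [- 4] times the smoothed logarithm, so it inherits
   measurability from it. *)
rewrite (_ : (fun _ => _) = (fun w : T => e * expR (- 4 * smoothed_log e (x - w.1) (y - w.2)))).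
  apply: measurable_funM => //; apply: measurableT_comp => //.
  by apply: measurable_funM => //; exact: measurable_smoothed_log.
apply/funext => w; rewrite /density /smoothed_log; set D := (_ + e).
have D0 : 0 < D by exact: Dgt0.
have -> : - 4 * (ln D / 2) = - (ln D + ln D) by field.
by rewrite expRN expRD lnK// -expr2.
Qed.

Lemma integrable_smoothed_log x y : mu.-integrable O (fun w => (smoothed_log e (x - w.1) (y - w.2))%:E).
Proof.
apply: (@bounded_le_integrable _ (`|ln e| + `|ln ((2 + 2 * `|W| + e) * (1 + x ^+ 2 + y ^+ 2))|)).
  exact: measurable_smoothed_log.
move=> w Ow; have h := le_sqdist x y Ow.
rewrite /smoothed_log; set D := ((x - _) ^+ 2 + _ + e); set B := ((2 + 2 * `|W| + e) * _).
have D0 : 0 < D by exact: Dgt0.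
have eD : e <= D by rewrite lerDr addr_ge0 ?sqr_ge0.
have h1 : ln e <= ln D by rewrite ler_ln ?posrE.
have h2 : ln D <= ln B by rewrite ler_ln ?posrE//; exact: lt_le_trans h.
rewrite ler_norml; apply/andP; split.
  have := ler_norm (- ln e); rewrite normrN; have := normr_ge0 (ln B); have := normr_ge0 (ln e); lra.
have := ler_norm (ln B); have := normr_ge0 (ln B); have := normr_ge0 (ln e); lra.
Qed.

Lemma density_le x y : density e x y <= e^-1.
Proof.
rewrite /density -[X in _ <= X]div1r ler_pdivrMr ?exprn_gt0// mulrAC mul1r.
rewrite ler_pdivlMr// -expr2 ler_pXn2r ?nnegrE ?(ltW e0) ?(ltW (Dgt0 _ _))//.
by rewrite lerDr addr_ge0 ?sqr_ge0.
Qed.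

Lemma integrable_density x y : mu.-integrable O (fun w => (density e (x - w.1) (y - w.2))%:E).
Proof.
apply: (@bounded_le_integrable _ e^-1); first exact: measurable_density.
by move=> w _; rewrite ger0_norm ?density_le// ltW// density_gt0.
Qed.

Lemma smoothed_mass_ge0 x y : 0 <= smoothed_mass x y.
Proof. by apply: Rintegral_ge0 => w _; rewrite ltW// density_gt0. Qed.

(** Since [O] lies in a fixed disc, the integrand is bounded on [O] by a constant in [w]. At
    infinity the bound grows like the mass of [O] times the logarithm of the distance. *)
Lemma potential_le x y : potential x y <=
  fine (mu O) / 2 * ln ((2 + 2 * `|W| + e) * (1 + x ^+ 2 + y ^+ 2)).
Proof.
rewrite mulrAC -mulrA mulrC -Rintegral_cst//; apply: le_Rintegral => //.
- exact: integrable_smoothed_log.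
- apply: (@bounded_le_integrable _ `|ln ((2 + 2 * `|W| + e) * (1 + x ^+ 2 + y ^+ 2)) / 2|) => //.
- move=> w /(le_sqdist x y) h; rewrite ler_pM2r ?invr_gt0// ler_ln ?posrE//.
  exact: lt_le_trans h.
Qed.

(** The pointwise bound [lap4_smoothed_log] is integrated in [w]; its error term is constant in [w]
    and picks up the mass of [O]. *)
Lemma lap4_potential x y a b : 8 * (a ^+ 2 + b ^+ 2) <= e ->
  2 * (a ^+ 2 + b ^+ 2) * smoothed_mass x y -
    32 / e ^+ 2 * fine (mu O) * (a ^+ 2 + b ^+ 2) ^+ 2
  <= lap4 potential x y a b.
Proof.
move=> hab.
pose k x y (w : T) := smoothed_log e (x - w.1) (y - w.2).
pose d (w : T) := density e (x - w.1) (y - w.2).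
pose c := 32 / e ^+ 2 * (a ^+ 2 + b ^+ 2) ^+ 2.
have ik x' y' : mu.-integrable O (EFin \o k x' y') by exact: integrable_smoothed_log.
have iD (f g : T -> R) : mu.-integrable O (EFin \o f) -> mu.-integrable O (EFin \o g) ->
    mu.-integrable O (EFin \o (fun w => f w + g w)).
  by move=> hf hg; exact: (integrableD mO hf hg).
have iZ r (f : T -> R) : mu.-integrable O (EFin \o f) ->
    mu.-integrable O (EFin \o (fun w => r * f w)).
  by move=> hf; exact: (integrableZl mO r hf).
have id : mu.-integrable O (EFin \o d) by exact: integrable_density.
have ic : mu.-integrable O (EFin \o (fun=> c)) by exact: (@bounded_le_integrable _ `|c|).
have i1 : mu.-integrable O (EFin \o (fun w => 2 * (a ^+ 2 + b ^+ 2) * d w + 4 * k x y w)).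
  by apply: iD; apply: iZ.
have i2 : mu.-integrable O (EFin \o (fun w => k (x + a) (y + b) w + k (x - a) (y - b) w)).
  by apply: iD.
have i3 : mu.-integrable O (EFin \o (fun w => k (x - b) (y + a) w + k (x + b) (y - a) w)).
  by apply: iD.
have i4 := iD _ _ i2 i3.
have : \int[mu]_(w in O) (2 * (a ^+ 2 + b ^+ 2) * d w + 4 * k x y w) <=
  \int[mu]_(w in O) (k (x + a) (y + b) w + k (x - a) (y - b) w +
     (k (x - b) (y + a) w + k (x + b) (y - a) w) + c).
  apply: le_Rintegral => //; first exact: iD.
  move=> w Ow; have := @lap4_smoothed_log _ (x - w.1) (y - w.2) _ _ _ e0 hab.
  rewrite /lap4 -/c -/(d w).
  rewrite (addrAC x (- w.1) a) (addrAC x (- w.1) (- a)) (addrAC x (- w.1) b).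
  rewrite (addrAC x (- w.1) (- b)) (addrAC y (- w.2) a) (addrAC y (- w.2) (- a)).
  rewrite (addrAC y (- w.2) b) (addrAC y (- w.2) (- b)) /k.
  set k0 := smoothed_log _ _ _; set k1 := smoothed_log _ _ _; set k2 := smoothed_log _ _ _.
  set k3 := smoothed_log _ _ _; set k4 := smoothed_log _ _ _; lra.
rewrite (RintegralD mO (iZ _ _ id) (iZ _ _ (ik x y))) (RintegralD mO i4 ic) (RintegralD mO i2 i3).
rewrite (RintegralD mO (ik _ _) (ik _ _)) (RintegralD mO (ik _ _) (ik _ _)).
rewrite (RintegralZl _ mO id) (RintegralZl _ mO (ik x y)) (Rintegral_cst _ mO).
rewrite /lap4 /potential /smoothed_mass /c /k /d.
set A := fine _; lra.
Qed.

End LogPotential.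

(** * Continuity of the smoothed potential *)

Section PotentialContinuity.
Variable R : realType.

Local Notation T := (measurableTypeR R * measurableTypeR R)%type.

(** The logarithm is Lipschitz with constant [1 / e] on [[e, +oo[]. Continuity of the potential then
    follows from an explicit bound. *)
Lemma smoothed_log_lipschitz (e a b a' b' : R) : 0 < e ->
  `|smoothed_log e a b - smoothed_log e a' b'| <= (`|a ^+ 2 - a' ^+ 2| + `|b ^+ 2 - b' ^+ 2|) / e.
Proof.
move=> e0.
suff H x y x' y' : smoothed_log e x y - smoothed_log e x' y' <=
    (`|x ^+ 2 - x' ^+ 2| + `|y ^+ 2 - y' ^+ 2|) / e.
  by rewrite ler_norml H andbT lerNl opprB (distrC (a ^+ 2)) (distrC (b ^+ 2)) H.
rewrite /smoothed_log -mulrBl; set D := _ + e; set D' := (X in _ - ln X).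
have D0 : 0 < D by rewrite ltr_wpDl// addr_ge0 ?sqr_ge0.
have D'0 : 0 < D' by rewrite ltr_wpDl// addr_ge0 ?sqr_ge0.
have eD' : e <= D' by rewrite lerDr addr_ge0 ?sqr_ge0.
set S := _ + `|_|; have S0 : 0 <= S by rewrite addr_ge0.
have DS : D - D' <= S.
  have -> : D - D' = (x ^+ 2 - x' ^+ 2) + (y ^+ 2 - y' ^+ 2) by rewrite /D /D'; ring.
  by rewrite lerD// ler_norm.
suff h : ln D - ln D' <= S / e by have := divr_ge0 S0 (ltW e0); lra.
rewrite -ln_div ?posrE//.
have -> : D / D' = 1 + (D - D') / D' by field; lra.
apply: le_trans (le_ln1Dx _) _.
  by rewrite -(ltrD2l 1) subrr -[X in X + _](divff (x := D')) ?gt_eqF// -mulrDl addrC subrK divr_gt0.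
rewrite ler_pdivrMr// mulrAC ler_pdivlMr//.
apply: (@le_trans _ _ (S * e)); first by rewrite ler_wpM2r// ltW.
by rewrite ler_wpM2l.
Qed.

Variables (mu : {measure set T -> \bar R}) (O : set T) (W e : R).
Hypotheses (mO : measurable O) (mu_fin : (mu O < +oo)%E) (OW : O `<=` disc 0 0 W)
  (e0 : 0 < e).

Lemma potential_lipschitz (x y x' y' : R) :
  `|potential mu O e x y - potential mu O e x' y'| <=
  fine (mu O) / e * (`|x - x'| * (`|x| + `|x'| + 2 * (1 + `|W|)) +
                     `|y - y'| * (`|y| + `|y'| + 2 * (1 + `|W|))).
Proof.
have ik := integrable_smoothed_log mO mu_fin OW e0.
rewrite /potential -(RintegralB mO (ik _ _) (ik _ _)).
apply: le_trans (le_normr_Rintegral mO (integrableB mO (ik _ _) (ik _ _))) _.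
set L := _ + _; have -> : fine (mu O) / e * L = e^-1 * L * fine (mu O) by ring.
rewrite -Rintegral_cst//.
apply: le_Rintegral => //.
- by apply: (integrable_norm (integrableB mO (ik _ _) (ik _ _))).
- exact: (@bounded_le_integrable _ _ _ mO mu_fin _ `|e^-1 * L|).
move=> w /OW; rewrite /disc/= !sub0r !sqrrN => hw.
have C0 : 0 <= 1 + `|W| by rewrite addr_ge0.
have WC : W <= (1 + `|W|) ^+ 2.
  by have := ler_norm W; have := normr_ge0 W; nra.
have [w1 w2] : `|w.1| <= 1 + `|W| /\ `|w.2| <= 1 + `|W|.
  have := sqr_ge0 w.1; have := sqr_ge0 w.2 => ? ?.
  split; rewrite -(@ler_pXn2r _ 2)// ?nnegrE// real_normK ?num_real//; lra.
apply: le_trans (smoothed_log_lipschitz _ _ _ _ e0) _.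
rewrite mulrC ler_pM2l ?invr_gt0// /L.
have sq (u u' v : R) : `|v| <= 1 + `|W| ->
    `|(u - v) ^+ 2 - (u' - v) ^+ 2| <= `|u - u'| * (`|u| + `|u'| + 2 * (1 + `|W|)).
  move=> hv; have -> : (u - v) ^+ 2 - (u' - v) ^+ 2 = (u - u') * (u + u' - 2 * v) by ring.
  rewrite normrM ler_wpM2l//.
  apply: le_trans (ler_normB _ _) _; apply: lerD; first exact: ler_normD.
  by rewrite normrM ger0_norm// ler_pM2l.
by apply: lerD; exact: sq.
Qed.

Lemma continuous_potential (X : topologicalType) (f g : X -> R) :
  continuous f -> continuous g -> continuous (fun p => potential mu O e (f p) (g p)).
Proof.
move=> cf cg p; pose B q := fine (mu O) / e *
   (`|f p - f q| * (`|f p| + `|f q| + 2 * (1 + `|W|)) +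
    `|g p - g q| * (`|g p| + `|g q| + 2 * (1 + `|W|))).
have cB : B q @[q --> p] --> B p.
  apply: cvgM; first exact: cvg_cst.
  have h (u : X -> R) : continuous u -> `|u p - u q| * (`|u p| + `|u q| + 2 * (1 + `|W|)) @[q --> p] -->
      `|u p - u p| * (`|u p| + `|u p| + 2 * (1 + `|W|)).
    move=> cu; apply: cvgM.
      by apply: cvg_norm; apply: cvgB; [exact: cvg_cst|exact: cu].
    apply: cvgD; last exact: cvg_cst.
    by apply: cvgD; [exact: cvg_cst|apply: cvg_norm; exact: cu].
  by apply: cvgD; exact: h.
have B0 : B p = 0 by rewrite /B !subrr normr0 !mul0r addr0 mulr0.
rewrite B0 in cB.
apply/cvgrPdist_le => eps eps0.
move/cvgrPdist_le : cB => /(_ _ eps0); apply: filterS => q.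
rewrite sub0r normrN => h; apply: le_trans (potential_lipschitz _ _ _ _) _.
exact: le_trans (ler_norm _) h.
Qed.

End PotentialContinuity.

(** * Lower bounds for the smoothed mass near a covered point *)

Section SmoothedMass.
Variable R : realType.

Local Notation T := (measurableTypeR R * measurableTypeR R)%type.
Local Notation mu := (@lebesgue_measure R \x @lebesgue_measure R)%E.

(* Lower Riemann sum of the radial integral over the annuli between the circles
   [|w|^2 + e = e q^j]. *)
Lemma smoothed_mass_disc_ge (e q x y : R) k : 0 < e -> 1 < q ->
  pi * (q^-1 * (1 - q ^- k)) <=
  smoothed_mass mu (disc x y (e * (q ^+ k - 1))) e x y.
Proof.
move=> e0 q1; have q0 : 0 < q by lra.
elim: k => [|k IH].
  by rewrite expr0 invr1 subrr !mulr0 smoothed_mass_ge0.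
pose s j := e * (q ^+ j - 1).
have s0 j : 0 <= s j by rewrite mulr_ge0 ?(ltW e0)// subr_ge0 exprn_ege1// ltW.
have mus j : mu (disc x y (s j)) = (pi * s j)%:E by rewrite disc_area.
have sS : s k <= s k.+1.
  by rewrite ler_pM2l// lerD2r ler_eXn2l// ltW.
have id D : measurable D -> (mu D < +oo)%E ->
    mu.-integrable D (fun w : T => (density e (x - w.1) (y - w.2))%:E).
  by move=> mD muD; exact: (integrable_density mD muD).
have mds j : measurable (disc x y (s j)) by exact: measurable_disc.
pose A := disc x y (s k.+1) `\` disc x y (s k).
have mA : measurable A by exact: measurableD.
have muA : mu A = (pi * (s k.+1 - s k))%:E.
  have muI : mu (disc x y (s k.+1) `&` disc x y (s k)) = (pi * s k)%:E.
    rewrite -mus; congr (mu _); apply/setIidPr => w; rewrite /disc/= => h.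
    exact: lt_le_trans h sS.
  transitivity (mu (disc x y (s k.+1)) - mu (disc x y (s k.+1) `&` disc x y (s k)))%E.
    by apply: measureD => //; rewrite [X in (X < _)%E]mus ltry.
  by rewrite muI mus mulrBr EFinB.
have dE : disc x y (s k.+1) = disc x y (s k) `|` A.
  apply/seteqP; split=> w; rewrite /A /disc/=.
    by move=> h; have [?|?] := pselect ((x - w.1) ^+ 2 + (y - w.2) ^+ 2 < s k); [left|right].
  by move=> [h|[]//]; exact: lt_le_trans h sS.
rewrite /smoothed_mass -/(s k.+1) dE Rintegral_setU//; last 2 first.
- by rewrite -dE; apply: id; rewrite ?mus ?ltry.
- by apply/disj_setPS => w [? []].
(* The increment is the area of the new annulus times the density on its outer circle, where the
   density is smallest; these increments form a geometric series. *)
have -> : pi * (q^-1 * (1 - q ^- k.+1)) =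
    pi * (q^-1 * (1 - q ^- k)) + (e / (s k.+1 + e) ^+ 2) * (pi * (s k.+1 - s k)).
  have -> : s k.+1 + e = e * q ^+ k.+1 by rewrite /s; ring.
  by rewrite /s exprS; field; rewrite expf_neq0 ?gt_eqF.
apply: lerD; first exact: IH.
have -> : (e / (s k.+1 + e) ^+ 2) * (pi * (s k.+1 - s k)) =
   \int[mu]_(w in A) (e / (s k.+1 + e) ^+ 2).
  by rewrite Rintegral_cst// [X in fine X]muA.
apply: le_Rintegral => //.
- by apply: (bounded_le_integrable mA _ _ (M := `|e / (s k.+1 + e) ^+ 2|)) => //; rewrite [X in (X < _)%E]muA ltry.
- by apply: id => //; rewrite [X in (X < _)%E]muA ltry.
move=> w [h _]; rewrite /density ler_pM2l//.
have D0 : 0 < (x - w.1) ^+ 2 + (y - w.2) ^+ 2 + e by rewrite ltr_wpDl// addr_ge0 ?sqr_ge0.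
have se0 : 0 < s k.+1 + e by rewrite ltr_wpDl.
rewrite lef_pV2 ?posrE ?exprn_gt0//.
by rewrite ler_pXn2r ?nnegrE ?(ltW D0) ?(ltW se0)// lerD2r ltW.
Qed.

Lemma smoothed_mass_ge (th eta : R) : 0 <= th -> th < 1 -> 0 < eta ->
  exists2 e, 0 < e & forall (O : set T) x y, measurable O -> (mu O < +oo)%E ->
    disc x y eta `<=` O -> pi * th <= smoothed_mass mu O e x y.
Proof.
move=> th0 th1 eta0.
(* With [q^-1 = (1 + th) / 2] and [q ^- N <= (1 - th) / (1 + th)], the quantity
   [q^-1 * (1 - q ^- N)] is at least [th]. *)
pose q := 2 / (1 + th).
have q1 : 1 < q by rewrite ltr_pdivlMr; lra.
have q0 : 0 < q by lra.
have [N hN] : exists N, q ^- N <= (1 - th) / (1 + th).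
  have : (q^-1) ^+ n @[n --> \oo] --> 0.
    by apply: cvg_expr; rewrite ger0_norm ?invf_lt1// invr_ge0 ltW.
  have c0 : 0 < (1 - th) / (1 + th) by apply: divr_gt0; lra.
  move=> /cvgrPdist_le/(_ _ c0)[N _ /(_ N (leqnn N))].
  by rewrite sub0r normrN exprVn => h; exists N; exact: le_trans (ler_norm _) h.
have qN : 1 <= q ^+ N by rewrite exprn_ege1// ltW.
have qN0 : 0 < q ^+ N by lra.
(* The disc of squared radius [e * (q ^+ N - 1)] then fits into the disc of squared radius [eta].
   The choice depends neither on [O] nor on the point. *)
exists (eta / q ^+ N); first exact: divr_gt0.
move=> O x y mO muO dO.
set e := eta / _; have e0 : 0 < e by exact: divr_gt0.
have h := smoothed_mass_disc_ge x y N e0 q1.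
set D := disc _ _ _ in h.
have DO : D `<=` O.
  apply: subset_trans dO => w; rewrite /D /disc/= => /lt_le_trans; apply.
  rewrite /e mulrBr mulr1 divfK ?gt_eqF// gerBl ltW// divr_gt0.
have mD : measurable D by exact: measurable_disc.
apply: (@le_trans _ _ (pi * (q^-1 * (1 - q ^- N)))).
  rewrite ler_pM2l ?pi_gt0//.
  have -> : q^-1 = (1 + th) / 2 by rewrite /q; field; lra.
  have : (1 + th) / 2 * q ^- N <= (1 + th) / 2 * ((1 - th) / (1 + th)).
    by rewrite ler_pM2l//; lra.
  have -> : (1 + th) / 2 * ((1 - th) / (1 + th)) = (1 - th) / 2 by field; lra.
  lra.
apply: le_trans h _; rewrite /smoothed_mass.
have OE : O = D `|` (O `\` D) by rewrite setDUK.
rewrite [in leRHS]OE.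
have mOD : measurable (O `\` D) by exact: measurableD.
rewrite Rintegral_setU//.
- by rewrite lerDl Rintegral_ge0// => w _; rewrite ltW// density_gt0.
- by rewrite setDUK//; exact: integrable_density.
- by apply/disj_setPS => w [? []].
Qed.

End SmoothedMass.

(** * Linear algebra in C^d *)

Lemma continuous_sumr (R : realType) (X : topologicalType) (I : Type) (s : seq I)
    (F : I -> X -> R) :
  (forall i, continuous (F i)) -> continuous (fun x => \sum_(i <- s) F i x).
Proof.
move=> cF; elim: s => [|i s IH].
  by under eq_fun do rewrite big_nil; move=> x; exact: cvg_cst.
by under eq_fun do rewrite big_cons; move=> x; apply: cvgD; [exact: cF|exact: IH].
Qed.

Section SectionCoordinate.
Variables (R : realType) (n : nat).
Local Notation d := n.+1.
Implicit Types (z h : 'cV[R[i]]_d) (Q : 'M[R[i]]_d) (c : R[i]).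

Definition sqmod c : R := complex.Re c ^+ 2 + complex.Im c ^+ 2.

Definition sqnorm z : R := \sum_(k < d) sqmod (z k 0).

(* The coordinate in which the plank of unitary [Q] is a cylinder. *)
Definition section_coord Q z : R[i] := (map_mx Num.conj Q^T *m z) 0 0.

Lemma sqmod_ge0 c : 0 <= sqmod c.
Proof. by rewrite addr_ge0 ?sqr_ge0. Qed.

Lemma sqnorm_ge0 z : 0 <= sqnorm z.
Proof. by apply: sumr_ge0 => k _; exact: sqmod_ge0. Qed.

Lemma sqnorm0 : sqnorm 0 = 0.
Proof. by rewrite /sqnorm big1// => k _; rewrite mxE /sqmod/= expr0n addr0. Qed.

Lemma sqmodM (c c' : R[i]) : sqmod (c * c') = sqmod c * sqmod c'.
Proof. by case: c c' => [a b] [a' b']; rewrite /sqmod/=; ring. Qed.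

Lemma sqnormZ c z : sqnorm (c *: z) = sqmod c * sqnorm z.
Proof. by rewrite /sqnorm mulr_sumr; apply: eq_bigr => k _; rewrite mxE sqmodM. Qed.

Lemma sqmod_real (t : R) : sqmod t%:C%C = t ^+ 2.
Proof. by rewrite /sqmod/= expr0n addr0. Qed.

Lemma sqmod_i : sqmod 'i%C = 1.
Proof. by rewrite /sqmod/= expr0n expr1n add0r. Qed.

Lemma sqnorm_complex z : ((sqnorm z)%:C)%C = (map_mx Num.conj z^T *m z) 0 0.
Proof.
rewrite mxE rmorph_sum; apply: eq_bigr => k _; rewrite !mxE.
by rewrite mulrC -normCK; exact: add_Re2_Im2.
Qed.

Lemma sqnorm_unitary Q z : Q \is unitarymx ->
  sqnorm (map_mx Num.conj Q^T *m z) = sqnorm z.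
Proof.
move=> /unitarymxP QQ.
have : ((sqnorm (map_mx Num.conj Q^T *m z))%:C)%C = ((sqnorm z)%:C)%C :> R[i].
  rewrite !sqnorm_complex trmx_mul map_mxM/= map_trmx trmxK.
  have -> : map_mx Num.conj (map_mx Num.conj Q) = Q.
    by apply/matrixP => i j; rewrite !mxE conjCK.
  by rewrite mulmxA -(mulmxA _ Q) QQ mulmx1.
by move=> /complexI.
Qed.

Lemma sqmod_section_coord_le Q z : Q \is unitarymx -> sqmod (section_coord Q z) <= sqnorm z.
Proof.
move=> uQ; rewrite -(sqnorm_unitary z uQ) /sqnorm (bigD1 0)//= lerDl.
by apply: sumr_ge0 => k _; exact: sqmod_ge0.
Qed.

Lemma section_coordD Q z h : section_coord Q (z + h) = section_coord Q z + section_coord Q h.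
Proof. by rewrite /section_coord mulmxDr mxE. Qed.

Lemma section_coordZ Q c z : section_coord Q (c *: z) = c * section_coord Q z.
Proof. by rewrite /section_coord -scalemxAr mxE. Qed.

Lemma mul_adjoint_col0 Q : Q \is unitarymx ->
  map_mx Num.conj Q^T *m col 0 Q = delta_mx 0 0.
Proof.
move=> /unitarymxP/mulmx1C QQ.
rewrite colE mulmxA [X in X *m _ = _]QQ mul1mx.
by [].
Qed.

(** The first column of [Q] is the unit vector along which the section coordinate moves at unit
    speed; Laplacians in the direction of a section are tested along it. *)
Lemma section_coord_col0 Q : Q \is unitarymx -> section_coord Q (col 0 Q) = 1.
Proof. by move=> uQ; rewrite /section_coord mul_adjoint_col0// mxE !eqxx. Qed.

Lemma sqnorm_col0 Q : Q \is unitarymx -> sqnorm (col 0 Q) = 1.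
Proof.
move=> uQ; rewrite -(sqnorm_unitary _ uQ) mul_adjoint_col0//.
rewrite /sqnorm (bigD1 0)//= big1 ?addr0; first by rewrite mxE /sqmod/= expr1n expr0n addr0.
by move=> k k0; rewrite mxE (negbTE k0) /sqmod/= expr0n addr0.
Qed.

Lemma plank_setP (P : unitary_plank R n) z :
  plank_set P z -> plank_section P (section_coord (plank_unitary P) z).
Proof.
case=> w Kw <-; rewrite /section_coord mulmxA.
by move/unitarymxP/mulmx1C : (plank_unitaryP P) => ->; rewrite mul1mx.
Qed.

(** The cross term is absorbed by [2 a a' <= a^2 + a'^2], weighted by [t]. *)
Lemma sqnormD_le z h (t : R) : 0 < t ->
  sqnorm (z + t%:C%C *: h) <= (1 + t) * sqnorm z + (t + t ^+ 2) * sqnorm h.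
Proof.
move=> t0; rewrite /sqnorm !mulr_sumr -big_split/=; apply: ler_sum => k _.
rewrite !mxE; case: (z k 0) (h k 0) => [a b] [a' b']; rewrite /sqmod/=.
have := mulr_ge0 (ltW t0) (sqr_ge0 (a - a')); have := mulr_ge0 (ltW t0) (sqr_ge0 (b - b')).
lra.
Qed.

(** To second order in [h], the Laplacian at 0 of [t |-> F (z + t *: h)] for complex [t], that is,
    on a complex line through [z]. *)
Definition vlap4 (F : 'cV[R[i]]_d -> R) z h : R :=
  F (z + h) + F (z - h) + F (z + 'i%C *: h) + F (z - 'i%C *: h) - 4 * F z.

Lemma vlap4_sqnorm z h : vlap4 sqnorm z h = 4 * sqnorm h.
Proof.
rewrite /vlap4 /sqnorm !mulr_sumr -!big_split -sumrB/=; apply: eq_bigr => k _.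
rewrite !mxE; case: (z k 0) (h k 0) => [a b] [a' b']; rewrite /sqmod/=; ring.
Qed.

(** The section coordinate is complex linear, so multiplying the step by ['i] rotates its section
    coordinate by a right angle, as in [lap4]. *)
Lemma vlap4_section_coord (U : R -> R -> R) Q z h :
  vlap4 (fun z => U (complex.Re (section_coord Q z)) (complex.Im (section_coord Q z))) z h =
  lap4 U (complex.Re (section_coord Q z)) (complex.Im (section_coord Q z))
    (complex.Re (section_coord Q h)) (complex.Im (section_coord Q h)).
Proof.
rewrite /vlap4 /lap4 -[- h]scaleN1r -[- ('i%C *: h)]scaleN1r !section_coordD !section_coordZ.
case: (section_coord Q z) (section_coord Q h) => [a b] [a' b'] /=.
rewrite !(mul0r, mul1r, mulN1r, sub0r, subr0, add0r, addr0, oppr0, mulNr, opprK).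
by [].
Qed.

(** Continuity and compactness are expressed on real row vectors, through this identification of
    R^(2d) with C^d. *)
Definition complex_of_real_coords (v : 'rV[R]_(d + d)) : 'cV[R[i]]_d :=
  \col_k (v 0 (lshift d k) +i* v 0 (rshift d k))%C.

Definition real_coords z : 'rV[R]_(d + d) :=
  row_mx (\row_k complex.Re (z k 0)) (\row_k complex.Im (z k 0)).

Lemma real_coordsK z : complex_of_real_coords (real_coords z) = z.
Proof.
apply/matrixP => k j; rewrite ord1 mxE /real_coords row_mxEl row_mxEr !mxE.
by case: (z k 0).
Qed.

Lemma continuous_section_coord Q :
  continuous (fun v => complex.Re (section_coord Q (complex_of_real_coords v))) /\
  continuous (fun v => complex.Im (section_coord Q (complex_of_real_coords v))).
Proof.
have ReD (a b : R[i]) : complex.Re (a + b) = complex.Re a + complex.Re b by case: a b => [? ?] [].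
have ImD (a b : R[i]) : complex.Im (a + b) = complex.Im a + complex.Im b by case: a b => [? ?] [].
have cc j : continuous (fun v : 'rV[R]_(d + d) => v 0 j) by exact: coord_continuous.
have cM (c : R) j : continuous (fun v : 'rV[R]_(d + d) => c * v 0 j).
  move=> v; have := @continuousM _ _ (cst c) (fun v : 'rV[R]_(d + d) => v 0 j) v.
  by apply; [exact: cst_continuous|exact: cc].
split.
- rewrite (_ : (fun _ => _) = (fun v : 'rV[R]_(d + d) => \sum_(k < d)
      (complex.Re (map_mx Num.conj Q^T 0 k) * v 0 (lshift d k) -
       complex.Im (map_mx Num.conj Q^T 0 k) * v 0 (rshift d k)))).
    apply: continuous_sumr => k v.
    exact: (continuousB (cM _ _ v) (cM _ _ v)).
  apply/funext => v; rewrite /section_coord mxE (big_morph _ ReD (erefl : complex.Re (0 : R[i]) = 0)).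
  by apply: eq_bigr => k _; rewrite [complex_of_real_coords v _ _]mxE; case: (map_mx _ _ _ _).
- rewrite (_ : (fun _ => _) = (fun v : 'rV[R]_(d + d) => \sum_(k < d)
      (complex.Re (map_mx Num.conj Q^T 0 k) * v 0 (rshift d k) +
       complex.Im (map_mx Num.conj Q^T 0 k) * v 0 (lshift d k)))).
    apply: continuous_sumr => k v.
    exact: (continuousD (cM _ _ v) (cM _ _ v)).
  apply/funext => v; rewrite /section_coord mxE (big_morph _ ImD (erefl : complex.Im (0 : R[i]) = 0)).
  by apply: eq_bigr => k _; rewrite [complex_of_real_coords v _ _]mxE; case: (map_mx _ _ _ _).
Qed.

Lemma continuous_sqnorm : continuous (fun v => sqnorm (complex_of_real_coords v)).
Proof.
have cc j : continuous (fun v : 'rV[R]_(d + d) => v 0 j) by exact: coord_continuous.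
have cc2 j : continuous (fun v : 'rV[R]_(d + d) => v 0 j ^+ 2).
  move=> v; apply: (@continuous_comp _ _ _ (fun v : 'rV[R]_(d + d) => v 0 j) (fun u => u ^+ 2)); first exact: cc.
  exact: exprn_continuous.
rewrite (_ : (fun _ => _) = (fun v : 'rV[R]_(d + d) => \sum_(k < d)
      (v 0 (lshift d k) ^+ 2 + v 0 (rshift d k) ^+ 2))).
  by apply: continuous_sumr => k v; exact: (continuousD (cc2 _ v) (cc2 _ v)).
by apply/funext => v; apply: eq_bigr => k _; rewrite mxE.
Qed.

Lemma compact_sqnorm_le (S : R) : compact [set v | sqnorm (complex_of_real_coords v) <= S].
Proof.
apply: bounded_closed_compact; last first.
  rewrite [X in closed X](_ : _ = (fun v => sqnorm (complex_of_real_coords v)) @^-1` [set x | x <= S]).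
    by apply: closed_comp => [v _|]; [exact: continuous_sqnorm|exact: closed_le].
  by [].
exists (1 + `|S|); split; first exact: num_real.
move=> M SM v /= vS; rewrite [leLHS]/Num.norm/= mx_normrE.
have M0 : 0 <= M by have := normr_ge0 S; lra.
apply/bigmax_leP; split=> // -[i j] _ /=; rewrite ord1.
have hj : v 0 j ^+ 2 <= sqnorm (complex_of_real_coords v).
  rewrite /sqnorm; case: (split_ordP j) => k ->; rewrite (bigD1 k)//= !mxE /sqmod/=.
    rewrite -addrA lerDl addr_ge0 ?sqr_ge0//; apply: sumr_ge0 => *; exact: sqmod_ge0.
  rewrite addrAC lerDr addr_ge0 ?sqr_ge0//; apply: sumr_ge0 => *; exact: sqmod_ge0.
rewrite -(@ler_pXn2r _ 2)// ?nnegrE// real_normK ?num_real//.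
have := ler_norm S; have := normr_ge0 S; nra.
Qed.

End SectionCoordinate.

(** * The maximum principle *)

(** This is the passage to the limit [t -> 0] in a four-point inequality already divided by the
    square of the step. *)
Lemma le0_of_le_sqr (R : realFieldType) (X Y t0 : R) : 0 < t0 -> 0 <= Y ->
  (forall t, 0 < t -> t < t0 -> X <= Y * t ^+ 2) -> X <= 0.
Proof.
move=> t00 Y0 H; rewrite leNgt; apply/negP => X0.
pose t := Num.min (t0 / 2) (Num.min 1 (X / (2 * (Y + 1)))).
have t_gt0 : 0 < t by rewrite !lt_min divr_gt0//= ltr01 divr_gt0// mulr_gt0// ltr_wpDl.
have tt0 : t < t0 by rewrite gt_min ltr_pdivrMr// ltr_pMr// ltr1n.
have t1 : t <= 1 by rewrite /t !ge_min lexx orbT.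
have tX : t <= X / (2 * (Y + 1)) by rewrite /t !ge_min lexx !orbT.
have := H t t_gt0 tt0; apply/negP; rewrite -ltNge.
apply: (@le_lt_trans _ _ (Y * t)).
  by rewrite ler_wpM2l// expr2 ler_piMr// ltW.
have : t * (2 * (Y + 1)) <= X by rewrite -ler_pdivlMr// mulr_gt0// ltr_wpDl.
have := mulr_ge0 Y0 (ltW t_gt0); lra.
Qed.

Lemma sumr_const_seq (R : nmodType) (I : Type) (s : seq I) (x : R) :
  \sum_(i <- s) x = x *+ size s.
Proof. by rewrite big_const_seq count_predT iter_addr_0. Qed.

(** Maximality at the four points bounds the four-point difference of [u] by [4 * c * T], where [T]
    is the squared length of the step; the lower bound with density [X] and error [N * T ^+ 2] is
    compared with it. *)
Lemma four_point_interior (R : realFieldType)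
    (c T X N u0 u1 u2 u3 u4 s0 s1 s2 s3 s4 : R) :
  u1 - c * s1 <= u0 - c * s0 -> u2 - c * s2 <= u0 - c * s0 ->
  u3 - c * s3 <= u0 - c * s0 -> u4 - c * s4 <= u0 - c * s0 ->
  s1 + s2 + s3 + s4 - 4 * s0 = 4 * T ->
  2 * T * X - N * T ^+ 2 <= u1 + u2 + u3 + u4 - 4 * u0 ->
  T * (2 * X - 4 * c) <= T * (N * T).
Proof. by move=> e1 e2 e3 e4 /(congr1 ( *%R c)) e5 e6; lra. Qed.

(** Here [s] is the squared norm of the maximum, [ls] stands for its logarithm, and [l1], [l2], [l3]
    for the logarithms of the factors by which the four points multiply it. The four factors sum to
    [4 + 4 * t ^+ 2], which produces the left-hand side. *)
Lemma four_point_exterior (R : realFieldType)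
    (eps N g k lr ls l1 l2 l3 s t u0 u1 u2 u3 u4 : R) :
  u1 - (g + k * (l1 + ls - lr)) + eps * ((1 + t) ^+ 2 * s) <=
    u0 - (g + k * (ls - lr)) + eps * s ->
  u2 - (g + k * (l2 + ls - lr)) + eps * ((1 - t) ^+ 2 * s) <=
    u0 - (g + k * (ls - lr)) + eps * s ->
  u3 - (g + k * (l3 + ls - lr)) + eps * ((1 + t ^+ 2) * s) <=
    u0 - (g + k * (ls - lr)) + eps * s ->
  u4 - (g + k * (l3 + ls - lr)) + eps * ((1 + t ^+ 2) * s) <=
    u0 - (g + k * (ls - lr)) + eps * s ->
  k * (l1 + l2 + l3 + l3) <= 0 ->
  - (N * (t ^+ 2 * s) ^+ 2) <= u1 + u2 + u3 + u4 - 4 * u0 ->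
  t ^+ 2 * (4 * eps * s) <= t ^+ 2 * (N * s ^+ 2 * t ^+ 2).
Proof. by move=> e1 e2 e3 e4 e5 e6; lra. Qed.

Section MaximumPrinciple.
Variables (R : realType) (n : nat) (I : eqType) (J : seq I).
Variables (Q : I -> 'M[R[i]]_n.+1) (U V : I -> R -> R -> R) (a : I -> R).
Variables (B C al A rho : R).
Hypotheses (uQ : forall i, Q i \is unitarymx) (a_ge0 : forall i, 0 <= a i)
  (B1 : 1 <= B) (C0 : 0 <= C) (al0 : 0 < al) (rho0 : 0 < rho).

Let re i z := complex.Re (section_coord (Q i) z).
Let im i z := complex.Im (section_coord (Q i) z).

Hypotheses
  (contU : forall i, continuous (fun v =>
     U i (re i (complex_of_real_coords v)) (im i (complex_of_real_coords v))))
  (growthU : forall i x y, U i x y <= a i / 2 * ln (B * (1 + x ^+ 2 + y ^+ 2)))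
  (lapU : forall i (x y p q : R), p ^+ 2 + q ^+ 2 <= al ->
     2 * (p ^+ 2 + q ^+ 2) * V i x y - C * (p ^+ 2 + q ^+ 2) ^+ 2 <= lap4 (U i) x y p q)
  (V_ge0 : forall i x y, 0 <= V i x y)
  (sum_a : \sum_(i <- J) a i < A).

Let u z := \sum_(i <- J) U i (re i z) (im i z).
(** The derivative of [A / 2 * ln s] at [rho], so that the two pieces of [G] have the same slope
    there. *)
Let c := A / (2 * rho).

(* The C^1 gluing of [c s] for [s <= rho] and of a logarithm growing like [A / 2 * ln s]
   beyond; it is faster than the growth of [u] and, on complex lines through the origin,
   [G (sqnorm z)] is harmonic beyond [rho]. *)
Let G s := c * Num.min s rho + A / 2 * ln (Num.max s rho / rho).

Let A0 : 0 < A.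
Proof. by apply: le_lt_trans sum_a; apply: sumr_ge0. Qed.

Let G_small s : s <= rho -> G s = c * s.
Proof.
move=> h; rewrite /G min_l// max_r// divff ?gt_eqF// ln1 mulr0 addr0//.
Qed.

Let G_large s : rho <= s -> G s = c * rho + A / 2 * (ln s - ln rho).
Proof.
move=> h; rewrite /G min_r// max_l// ln_div// posrE//.
exact: lt_le_trans h.
Qed.

(** Beyond [rho] the logarithm lies below its tangent at [rho], which is the line [c * s]. *)
Let G_le s : G s <= c * s.
Proof.
have [h|/ltW h] := leP s rho; first by rewrite G_small.
have s0 : 0 < s by exact: lt_le_trans h.
rewrite G_large// -ln_div ?posrE//.
have : ln (1 + (s / rho - 1)) <= s / rho - 1.
  by apply: le_ln1Dx; have := divr_gt0 s0 rho0; lra.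
rewrite addrC subrK => hl.
apply: (@le_trans _ _ (c * rho + A / 2 * (s / rho - 1))).
  by rewrite lerD2l ler_pM2l// divr_gt0.
by rewrite le_eqVlt; apply/orP; left; apply/eqP; rewrite /c; field; rewrite gt_eqF.
Qed.

Let continuous_G : continuous G.
Proof.
move=> s; apply: cvgD.
  apply: cvgM; first exact: cvg_cst.
  by apply: continuous_min; [exact: cvg_id|exact: cvg_cst].
apply: cvgM; first exact: cvg_cst.
have cM : {for s, continuous (fun s => Num.max s rho / rho)}.
  apply: cvgM; last exact: cvg_cst.
  by apply: continuous_max; [exact: cvg_id|exact: cvg_cst].
apply: (continuous_comp cM); apply: continuous_ln.
by rewrite divr_gt0// lt_max rho0 orbT.
Qed.

Let u_growth z : u z <= (\sum_(i <- J) a i) / 2 * ln (B * (1 + sqnorm z)).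
Proof.
rewrite /u !mulr_suml; apply: ler_sum => i _; apply: le_trans (growthU _ _ _) _.
apply: ler_wpM2l; first by rewrite divr_ge0.
have h : re i z ^+ 2 + im i z ^+ 2 <= sqnorm z by exact: sqmod_section_coord_le.
have B0 : 0 < B by exact: lt_le_trans ltr01 B1.
have p1 := sqr_ge0 (re i z); have p2 := sqr_ge0 (im i z); have p3 := sqnorm_ge0 z.
rewrite ler_ln ?posrE ?mulr_gt0//; try lra.
by rewrite ler_pM2l// -addrA lerD2l.
Qed.

Let vlap4_u z h : vlap4 u z h =
  \sum_(i <- J) lap4 (U i) (re i z) (im i z) (re i h) (im i h).
Proof.
rewrite /vlap4 /u mulr_sumr -!big_split -sumrB/=; apply: eq_bigr => i _.
exact: (vlap4_section_coord (U i) (Q i) z h).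
Qed.

Let lap4_lower i z h : sqnorm h <= al ->
  2 * sqmod (section_coord (Q i) h) * V i (re i z) (im i z) - C * sqnorm h ^+ 2
  <= lap4 (U i) (re i z) (im i z) (re i h) (im i h).
Proof.
move=> hal; have hh := sqmod_section_coord_le h (uQ i).
have hp : re i h ^+ 2 + im i h ^+ 2 <= al by exact: le_trans hal.
apply: le_trans (lapU i (re i z) (im i z) hp).
rewrite -/(sqmod (section_coord (Q i) h)) lerD2l lerN2 ler_wpM2l//.
by rewrite ler_pXn2r ?nnegrE ?sqmod_ge0 ?sqnorm_ge0.
Qed.

(** Plurisubharmonicity of [u], up to an error of fourth order in the step: the terms with [V] are
    nonnegative and are dropped. *)
Let vlap4_u_lower z h : sqnorm h <= al ->
  - ((size J)%:R * C * sqnorm h ^+ 2) <= vlap4 u z h.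
Proof.
move=> hal; rewrite vlap4_u -mulrA mulr_natl -sumr_const_seq -sumrN.
apply: ler_sum => i _; apply: le_trans (lap4_lower _ _ hal).
by rewrite -[leLHS]add0r lerD2r mulr_ge0// mulr_ge0// sqmod_ge0.
Qed.

Let vlap4_u_lower_at i z h : i \in J -> sqnorm h <= al ->
  2 * sqmod (section_coord (Q i) h) * V i (re i z) (im i z) -
    (size J)%:R * C * sqnorm h ^+ 2 <= vlap4 u z h.
Proof.
move=> iJ hal; rewrite vlap4_u.
have -> : (size J)%:R * C * sqnorm h ^+ 2 = \sum_(i <- J) C * sqnorm h ^+ 2.
  by rewrite sumr_const_seq -mulrA mulr_natl.
rewrite !(big_rem i iJ)/= opprD addrA; apply: lerD; first exact: lap4_lower.
rewrite -sumrN; apply: ler_sum => j _; apply: le_trans (lap4_lower _ _ hal).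
by rewrite -[leLHS]add0r lerD2r mulr_ge0// mulr_ge0// sqmod_ge0.
Qed.

(** Short steps keep all four points in the ball on which maximality is known, and satisfy the bound
    [al] needed for the difference estimates. *)
Let sqnorm_near (z h : 'cV[R[i]]_n.+1) S : sqnorm z < S -> exists2 t0 : R, 0 < t0 &
  forall t, 0 < t -> t < t0 -> [/\ t ^+ 2 * sqnorm h <= al,
     sqnorm (z + t%:C%C *: h) <= S, sqnorm (z - t%:C%C *: h) <= S,
     sqnorm (z + 'i%C *: (t%:C%C *: h)) <= S & sqnorm (z - 'i%C *: (t%:C%C *: h)) <= S].
Proof.
move=> zS; set m := sqnorm h; have m0 : 0 <= m by exact: sqnorm_ge0.
have z0 := sqnorm_ge0 z.
pose t0 := Num.min 1 (Num.min (al / (1 + m)) ((S - sqnorm z) / (1 + sqnorm z + 2 * m))).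
have p1 : 0 < 1 + m by lra.
have p2 : 0 < 1 + sqnorm z + 2 * m by lra.
exists t0; first by rewrite !lt_min ltr01/= !divr_gt0//= subr_gt0.
move=> t tpos; rewrite !lt_min => /and3P[t1].
rewrite !ltr_pdivlMr// => tal tS.
have tm : 0 <= t * m by rewrite mulr_ge0// ltW.
have tt : t ^+ 2 <= t by rewrite expr2 ler_piMl// ltW.
have ttm : t ^+ 2 * m <= t * m by rewrite ler_wpM2r.
have key h' : sqnorm h' = m -> sqnorm (z + t%:C%C *: h') <= S.
  move=> hm; apply: le_trans (sqnormD_le z h' tpos) _; rewrite hm; lra.
have mN : sqnorm (- h) = m by rewrite -scaleN1r sqnormZ /sqmod/= oppr0 sqrrN expr1n expr0n addr0 mul1r.
have mi : sqnorm ('i%C *: h) = m by rewrite sqnormZ sqmod_i mul1r.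
have miN : sqnorm (- ('i%C *: h)) = m.
  by rewrite -scaleN1r sqnormZ mi /sqmod/= oppr0 sqrrN expr1n expr0n addr0 mul1r.
split; first by lra.
- exact: key.
- by rewrite -scalerN; exact: key.
- by rewrite scalerA mulrC -scalerA; exact: key.
- by rewrite scalerA mulrC -scalerA -scalerN; exact: key.
Qed.

(** The step is [t] times the first column of [Q i]: its section coordinate is [t] and its squared
    norm [t ^+ 2]. The two four-point differences are compared and [t] tends to 0. *)
Let interior_max i z c' S : i \in J -> sqnorm z < S ->
  (forall w, sqnorm w <= S -> u w - c' * sqnorm w <= u z - c' * sqnorm z) ->
  V i (re i z) (im i z) <= 2 * c'.
Proof.
move=> iJ zS maxz; pose h := col 0 (Q i).
have h1 : sqnorm h = 1 by exact: sqnorm_col0.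
have [t0 t00 near_t] := sqnorm_near h zS.
suff : 2 * V i (re i z) (im i z) - 4 * c' <= 0 by lra.
apply: (@le0_of_le_sqr _ _ ((size J)%:R * C) t0) => //; first by rewrite mulr_ge0.
move=> t tpos tt0; have [tal m1 m2 m3 m4] := near_t t tpos tt0.
set k := t%:C%C *: h in m1 m2 m3 m4.
have kE : sqnorm k = t ^+ 2 by rewrite sqnormZ sqmod_real h1 mulr1.
have := vlap4_sqnorm z k; have := @vlap4_u_lower_at i z k iJ.
rewrite h1 mulr1 in tal; rewrite kE => /(_ tal).
rewrite section_coordZ section_coord_col0// mulr1 sqmod_real /vlap4.
move=> low lap.
have := four_point_interior (maxz _ m1) (maxz _ m2) (maxz _ m3) (maxz _ m4) lap low.
by rewrite ler_pM2l// exprn_gt0.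
Qed.

(** The step is a multiple of [z], along the complex line through 0. The logarithms there contribute
    with the favourable sign, so [eps] times the squared norm leaves a gain of order [t ^+ 2]
    against an error of order [t ^+ 4]. *)
Let no_exterior_max z S eps : 0 < eps -> rho < sqnorm z -> sqnorm z < S ->
  ~ (forall w, sqnorm w <= S ->
    u w - G (sqnorm w) + eps * sqnorm w <= u z - G (sqnorm z) + eps * sqnorm z).
Proof.
move=> eps0 rz zS maxz; set s := sqnorm z in rz zS maxz.
have s0 : 0 < s by exact: lt_trans rz.
have [t0 t00 near_t] := sqnorm_near z zS.
(* The last bound gives [rho <= (1 - t) ^+ 2 * s], so all four points stay where [G] is
   logarithmic. *)
pose t1 := Num.min t0 (Num.min 1 ((s - rho) / (2 * s))).
have t10 : 0 < t1.
  by rewrite !lt_min t00 ltr01/= divr_gt0 ?mulr_gt0// subr_gt0.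
suff : 4 * eps * s <= 0 by have := mulr_gt0 eps0 s0; lra.
apply: (@le0_of_le_sqr _ _ ((size J)%:R * C * s ^+ 2) t1) => //.
  by rewrite !mulr_ge0// ltW.
move=> t tpos; rewrite !lt_min => /and3P[tt0 tlt1 tts].
have {}tts : t * (2 * s) < s - rho by rewrite -ltr_pdivlMr// mulr_gt0.
have [tal m1 m2 m3 m4] := near_t t tpos tt0.
set k := t%:C%C *: z in m1 m2 m3 m4.
have kE : sqnorm k = t ^+ 2 * s by rewrite sqnormZ sqmod_real.
have ts : 0 < t * s by rewrite mulr_gt0.
have t2s : 0 < t ^+ 2 * s by rewrite mulr_gt0// exprn_gt0.
have sp : sqnorm (z + k) = (1 + t) ^+ 2 * s.
  by rewrite /k -{1}[z]scale1r -scalerDl sqnormZ /sqmod/= addr0 expr0n addr0.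
have sm : sqnorm (z - k) = (1 - t) ^+ 2 * s.
  by rewrite /k -{1}[z]scale1r -scalerBl sqnormZ /sqmod/= subr0 expr0n addr0.
have si : sqnorm (z + 'i%C *: k) = (1 + t ^+ 2) * s.
  rewrite /k scalerA -{1}[z]scale1r -scalerDl sqnormZ /sqmod/=; congr (_ * _); ring.
have sim : sqnorm (z - 'i%C *: k) = (1 + t ^+ 2) * s.
  rewrite /k scalerA -{1}[z]scale1r -scalerBl sqnormZ /sqmod/=; congr (_ * _); ring.
have q1 : 0 < (1 + t) ^+ 2 by rewrite exprn_gt0//; lra.
have q2 : 0 < (1 - t) ^+ 2 by rewrite exprn_gt0//; lra.
have q3 : 0 < 1 + t ^+ 2 by have := exprn_gt0 2 tpos; lra.
have r1 : rho <= (1 + t) ^+ 2 * s by lra.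
have r2 : rho <= (1 - t) ^+ 2 * s by lra.
have r3 : rho <= (1 + t ^+ 2) * s by lra.
have ln_le : A / 2 * (ln ((1 + t) ^+ 2) + ln ((1 - t) ^+ 2) + ln (1 + t ^+ 2) + ln (1 + t ^+ 2)) <= 0.
  rewrite mulr_ge0_le0 ?divr_ge0 ?(ltW A0)//.
  have q12 := mulr_gt0 q1 q2; have q123 := mulr_gt0 q12 q3.
  rewrite -lnM ?posrE// -lnM ?posrE// -lnM ?posrE//; apply: ln_le0.
  (* The discrete form of harmonicity of the logarithm of the squared norm: the product of the four
     factors is at most 1. *)
  have -> : (1 + t) ^+ 2 * (1 - t) ^+ 2 * (1 + t ^+ 2) * (1 + t ^+ 2) = (1 - t ^+ 4) ^+ 2 by ring.
  rewrite expr_le1//; first by rewrite gerBl exprn_ge0// ltW.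
  by rewrite subr_ge0 exprn_ile1// ltW.
have low := @vlap4_u_lower z k; rewrite kE in low; move: (low tal) => {}low.
have Gs := G_large (ltW rz).
have f1 := maxz _ m1; rewrite sp (G_large r1) Gs lnM ?posrE// in f1.
have f2 := maxz _ m2; rewrite sm (G_large r2) Gs lnM ?posrE// in f2.
have f3 := maxz _ m3; rewrite si (G_large r3) Gs lnM ?posrE// in f3.
have f4 := maxz _ m4; rewrite sim (G_large r3) Gs lnM ?posrE// in f4.
have := four_point_exterior f1 f2 f3 f4 ln_le low.
by rewrite ler_pM2l// exprn_gt0.
Qed.

(** As [A] exceeds the sum of the [a i], the term [A / 2 * ln S] wins for large [S]. With
    [S = expR X] the comparison becomes linear in [X]. *)
Let growth_radius K : exists S : R, [/\ rho < S, 1 <= S &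
  (\sum_(i <- J) a i) / 2 * ln (B * (1 + S)) - A / 2 * ln S + K < 0].
Proof.
set s := \sum_(i <- J) a i; have s0 : 0 <= s by exact: sumr_ge0.
pose L := s / 2 * ln (2 * B) + K.
have sA : 0 < A - s by rewrite subr_gt0.
pose X := 2 * `|L| / (A - s) + 1 + rho.
have r0 : 0 < rho by exact: rho0.
have X0 : 0 <= 2 * `|L| / (A - s) by rewrite divr_ge0 ?mulr_ge0// ltW.
have eX : 1 + X <= expR X by exact: expR_ge1Dx.
have B0 : 0 < B by exact: lt_le_trans ltr01 B1.
exists (expR X); split; [rewrite /X in eX *; lra|rewrite /X in eX *; lra|].
have e0 := expR_gt0 X.
have h1 : ln (B * (1 + expR X)) <= ln (2 * B) + X.
  have -> : ln (2 * B) + X = ln (2 * B * expR X).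
    by rewrite [RHS]lnM ?posrE// ?mulr_gt0// expRK.
  have p1 : 0 < 1 + expR X by rewrite addr_gt0.
  rewrite ler_ln ?posrE ?(mulr_gt0 B0 p1) ?(mulr_gt0 (mulr_gt0 _ B0))//.
  rewrite [2 * B]mulrC -mulrA ler_pM2l//; rewrite /X in eX *; lra.
have : s / 2 * ln (B * (1 + expR X)) <= s / 2 * (ln (2 * B) + X).
  by rewrite ler_wpM2l// divr_ge0.
rewrite expRK => h2.
suff : L < (A - s) / 2 * X by rewrite /L; lra.
have -> : (A - s) / 2 * X = `|L| + (A - s) / 2 * (1 + rho).
  by rewrite /X; field; rewrite gt_eqF.
have := ler_norm L; have : 0 < (A - s) / 2 * (1 + rho) by rewrite mulr_gt0 ?divr_gt0//; lra.
lra.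
Qed.

Lemma exists_small_density : exists2 z, sqnorm z <= rho &
  forall i, i \in J -> V i (re i z) (im i z) <= A / rho.
Proof.
(* The constant is chosen so that [Phi] below is smaller on the sphere [sqnorm z = S] than at 0; its
   summand 1 is the value of [S^-1 * sqnorm z] there. *)
have [S [rS S1 HS]] := growth_radius (1 + A / 2 * ln rho - c * rho - u 0).
have S0 : 0 < S by lra.
(* The last term makes the exterior argument strict and adds at most 1 on the ball
   [sqnorm z <= S]. *)
pose Phi z := u z - G (sqnorm z) + S^-1 * sqnorm z.
have cPhi : continuous (fun v : 'rV[R]_(n.+1 + n.+1) => Phi (complex_of_real_coords v)).
  have cu : continuous (fun v => u (complex_of_real_coords v)).
    exact: (@continuous_sumr _ _ _ J (fun i v =>
      U i (re i (complex_of_real_coords v)) (im i (complex_of_real_coords v))) contU).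
  have cG v : {for v, continuous (fun v : 'rV[R]_(n.+1 + n.+1) => G (sqnorm (complex_of_real_coords v)))}.
    exact: (continuous_comp (@continuous_sqnorm _ _ v) (@continuous_G _)).
  have cS v : {for v, continuous (fun v : 'rV[R]_(n.+1 + n.+1) => S^-1 * sqnorm (complex_of_real_coords v))}.
    exact: (continuousM (@cst_continuous _ _ S^-1 v) (@continuous_sqnorm _ _ v)).
  by move=> v; exact: (continuousD (continuousB (cu v) (cG v)) (cS v)).
have [v vS vmax] : exists2 v : 'rV[R]_(n.+1 + n.+1), sqnorm (complex_of_real_coords v) <= S &
    forall w, sqnorm (complex_of_real_coords w) <= S ->
      Phi (complex_of_real_coords w) <= Phi (complex_of_real_coords v).
  have [||v] := @compact_EVT_max _ _ (fun v : 'rV[R]_(n.+1 + n.+1) => Phi (complex_of_real_coords v)) _ _ (@compact_sqnorm_le R n S).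
  - by exists (real_coords 0); rewrite /= real_coordsK sqnorm0 ltW.
  - exact: continuous_subspaceT.
  rewrite inE => vS vmax; exists v => // w wS; apply: vmax; rewrite inE//.
set z := complex_of_real_coords v in vS vmax.
have zmax w : sqnorm w <= S -> Phi w <= Phi z.
  by move=> wS; have := vmax (real_coords w); rewrite real_coordsK; exact.
have zS : sqnorm z < S.
  rewrite lt_neqAle vS andbT; apply/negP => /eqP zE.
  have := zmax 0; rewrite sqnorm0 => /(_ (ltW S0)).
  rewrite /Phi zE sqnorm0 (G_small (ltW rho0)) (G_large (ltW rS)) mulVf ?gt_eqF// !mulr0.
  have := u_growth z; rewrite zE; lra.
have [zr|rz] := leP (sqnorm z) rho; last first.
  by exfalso; apply: (@no_exterior_max z S S^-1) => //; rewrite invr_gt0.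
exists z => // i iJ.
(* Since [G s <= c * s] with equality at the maximum, [z] also maximizes [u] minus [c - S^-1] times
   the squared norm over the whole ball. *)
have : V i (re i z) (im i z) <= 2 * (c - S^-1).
  apply: (@interior_max i z (c - S^-1) S) => // w wS.
  have := zmax w wS; rewrite /Phi (G_small zr); have := G_le (sqnorm w); lra.
have -> : A / rho = 2 * c by rewrite /c; field; rewrite gt_eqF.
have : 0 < S^-1 by rewrite invr_gt0.
lra.
Qed.

End MaximumPrinciple.

(** * The covering theorem *)

Lemma geometric_sum_le (R : realFieldType) (e : R) N : 0 <= e ->
  \sum_(k <- iota 0 N) e / 2 ^+ k.+1 <= e.
Proof.
move=> e0; suff -> : \sum_(k <- iota 0 N) e / 2 ^+ k.+1 = e - e / 2 ^+ N.
  by rewrite gerBl divr_ge0// exprn_ge0.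
elim: N => [|N IH]; first by rewrite big_nil expr0 divr1 subrr.
rewrite -addn1 iotaD big_cat IH big_seq1 add0n addn1 exprS /=; field.
by rewrite expf_neq0.
Qed.

(** From [(a + b)^2 <= 2 a^2 + 2 b^2]; the quarters appear because radii are squared. *)
Lemma sqdist_triangle (R : realFieldType) (p1 p2 q1 q2 w1 w2 e s : R) :
  (p1 - q1) ^+ 2 + (p2 - q2) ^+ 2 < s / 4 ->
  (q1 - w1) ^+ 2 + (q2 - w2) ^+ 2 < e -> e < s / 4 ->
  (p1 - w1) ^+ 2 + (p2 - w2) ^+ 2 < s.
Proof.
have := sqr_ge0 (p1 - q1 - (q1 - w1)); have := sqr_ge0 (p2 - q2 - (q2 - w2)); lra.
Qed.

Section Planks.
Variables (R : realType) (n : nat).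
Local Notation T := (measurableTypeR R * measurableTypeR R)%type.
Local Notation re Q z := (complex.Re (section_coord Q z)).
Local Notation im Q z := (complex.Im (section_coord Q z)).

Lemma complex_ballP (r : R) (z : 'cV[R[i]]_n.+1) :
  0 < r -> sqnorm z < r ^+ 2 -> complex_ball r z.
Proof.
move=> r0 zr; rewrite /complex_ball/= /euclidean_norm.
by rewrite -[ltRHS](ger0_norm (ltW r0)) -sqrtr_sqr ltr_sqrt// exprn_gt0.
Qed.

Lemma sum_seq_le_esum (I : choiceType) (s : seq I) (f : I -> \bar R) :
  uniq s -> (forall i, 0 <= f i)%E -> (\sum_(i <- s) f i <= \esum_(i in [set: I]) f i)%E.
Proof.
move=> us f0; apply: esum_ge; exists [set` s]; last by rewrite fsbig_seq.
by split=> //; exact: finite_seq.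
Qed.

(** Compactness gives a finite subcover and a Lebesgue number together: the same [N] bounds the
    codes of the indices and fixes the squared radius. *)
Lemma uniform_disc_cover (I : countType) (Q : I -> 'M[R[i]]_n.+1) (O : I -> set T) (rho : R) :
  (forall i, disc_open (O i)) ->
  (forall z, sqnorm z <= rho -> exists i, O i (re (Q i) z, im (Q i) z)) ->
  exists N, forall z, sqnorm z <= rho ->
    exists2 i, (pickle i < N)%N & disc (re (Q i) z) (im (Q i) z) N.+1%:R^-1 `<=` O i.
Proof.
move=> oO cover.
pose cv := @complex_of_real_coords R n.
have := (compact_near_coveringP _).1 (@compact_sqnorm_le R n rho).
move=> /(_ nat \oo (fun N v => exists2 i, (pickle i < N)%N &
  disc (re (Q i) (cv v)) (im (Q i) (cv v)) N.+1%:R^-1 `<=` O i) _) H.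
have [|N _ HN] := H.
  move=> v vr; have [i /oO[s s0 /= sO]] := cover _ vr.
  have s40 : 0 < s / 4 by rewrite divr_gt0.
  pose g v' := (re (Q i) (cv v) - re (Q i) (cv v')) ^+ 2 + (im (Q i) (cv v) - im (Q i) (cv v')) ^+ 2.
  have cg : {for v, continuous g}.
    have [cre cim] := continuous_section_coord (Q i).
    have sq (f : 'rV[R]_(n.+1 + n.+1) -> R) : continuous f -> {for v, continuous (fun v' => (f v - f v') ^+ 2)}.
      move=> cf; have cB : {for v, continuous (fun v' => f v - f v')}.
        exact: (continuousB (@cst_continuous _ _ (f v) v) (cf v)).
      exact: (continuous_comp cB (@exprn_continuous _ 2 _)).
    exact: (continuousD (sq _ cre) (sq _ cim)).
  have g0 : g v = 0 by rewrite /g !subrr expr0n addr0.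
  have near_g : \forall v' \near v, g v' < s / 4.
    by apply: (cvgr_lt (g v) cg); rewrite g0.
  have near_N : \forall N \near \oo, (pickle i < N)%N /\ (N.+1%:R^-1 < s / 4).
    near=> N; split; first by near: N; exact: nbhs_infty_gt.
    by near: N; exact: near_infty_natSinv_lt (PosNum s40).
  near=> v' N.
  have [iN Ns] : (pickle i < N)%N /\ (N.+1%:R^-1 < s / 4) by near: N.
  exists i => // w; rewrite /disc/= => hw; apply: sO; rewrite /disc/=.
  have hg : g v' < s / 4 by near: v'.
  exact: sqdist_triangle hg hw Ns.
  exists N => z zr; have := HN N (leqnn N) (real_coords z).
by rewrite /= /cv real_coordsK; exact.
Unshelve. all: by end_near. Qed.

End Planks.

Theorem corollary1p6 (R : realType) (n : nat) (r : R) (hr : 0 <= r)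
    (I : countType) (P : I -> unitary_plank R n)
    (hcover : @complex_ball R n r `<=` \bigcup_(i in [set: I]) plank_set (P i)) :
  ((pi * r ^+ 2)%:E <= \esum_(i in [set: I]) cross_section_area (P i))%E.
Proof.
have area_ge0 i : (0 <= cross_section_area (P i))%E by exact: mu_ext_ge0.
move: hr; rewrite le_eqVlt => /predU1P[<-|r0].
  by rewrite expr0n mulr0; exact: esum_ge0.
rewrite leNgt; apply/negP => small.
pose mu := (@lebesgue_measure R \x @lebesgue_measure R)%E.
have esum_fin : (\esum_(i in [set: I]) cross_section_area (P i))%E \is a fin_num.
  by rewrite ge0_fin_numE ?esum_ge0// (lt_le_trans small)// leey.
move: small; rewrite -(fineK esum_fin) lte_fin.
set s := fine _ => small; have s0 : 0 <= s by rewrite fine_ge0// esum_ge0.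
have area_fin i : (cross_section_area (P i) < +oo)%E.
  have := sum_seq_le_esum (s := [:: i]) isT area_ge0; rewrite big_seq1 => /le_lt_trans; apply.
  by rewrite -ge0_fin_numE// esum_ge0.
have area_fineK i : (fine (cross_section_area (P i)))%:E = cross_section_area (P i).
  by rewrite fineK// ge0_fin_numE.
have area_le (J : seq I) : uniq J -> \sum_(i <- J) fine (cross_section_area (P i)) <= s.
  move=> uJ; rewrite -lee_fin -sumEFin fineK//.
  apply: le_trans (sum_seq_le_esum uJ area_ge0).
  by apply: lee_sum => i _; rewrite area_fineK.
have r20 : 0 < r ^+ 2 by rewrite exprn_gt0.
have pi0 : 0 < pi :> R by exact: pi_gt0.
have pir0 : 0 < pi * r ^+ 2 by exact: mulr_gt0.
(* One [gap] is spent on enlarging the sections, a second one makes the total area strictly less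
   than [A], and [A] is still below [pi * r ^+ 2]. *)
pose gap := (pi * r ^+ 2 - s) / 4.
have gap0 : 0 < gap by rewrite divr_gt0// subr_gt0.
pose A := s + 2 * gap.
have A0 : 0 < A by rewrite /A; lra.
have A_small : A < pi * r ^+ 2 by rewrite /A /gap; lra.
pose kap := A / (pi * r ^+ 2).
have kap0 : 0 < kap by exact: divr_gt0.
have kap1 : kap < 1 by rewrite /kap ltr_pdivrMr// mul1r.
(* [th] both shrinks the ball, to squared radius [th * r ^+ 2], and weakens the lower bound [pi] on
   the smoothed mass to [pi * th]. The contradiction needs [A / rho < pi * th], that is,
   [kap < th ^+ 2], which is the arithmetic-geometric mean inequality for 1 and [kap]. *)
pose th := (1 + kap) / 2.
have th0 : 0 < th by rewrite /th; lra.
have th1 : th < 1 by rewrite /th; lra.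
have th2 : kap < th ^+ 2.
  have : 0 < (1 - kap) ^+ 2 by rewrite exprn_gt0// subr_gt0.
  by rewrite /th; lra.
pose rho := th * r ^+ 2.
have rho0 : 0 < rho by exact: mulr_gt0.
have rho_lt : rho < r ^+ 2 by rewrite /rho gtr_pMl.
have A_lt : A / rho < pi * th.
  have -> : A / rho = kap * pi / th.
    rewrite /kap /rho; move: (pi : R) pi0 => p p0.
    by field; rewrite !gt_eqF.
  by rewrite ltr_pdivrMr// -[ltRHS]mulrA -expr2 [ltLHS]mulrC ltr_pM2l.
have /choice[Om HO] i : exists O : set (measurableTypeR R * measurableTypeR R),
    [/\ measurable O, disc_open O, plane_of (plank_section (P i)) `&` disc 0 0 (r ^+ 2) `<=` O,
      O `<=` disc 0 0 (r ^+ 2) &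
      (mu O <= cross_section_area (P i) + (gap / 2 ^+ (pickle i).+1)%:E)%E].
  apply: area_disc_open_cover (ltW r20) _ (area_fin i).
  by rewrite divr_gt0// exprn_gt0.
have mO i : measurable (Om i) by have [] := HO i.
have OW i : Om i `<=` disc 0 0 (r ^+ 2) by have [] := HO i.
have muO i : (mu (Om i) <= (pi * r ^+ 2)%:E)%E.
  rewrite -(disc_area 0 0 (ltW r20)); apply: le_measure (OW i); rewrite inE//.
  exact: measurable_disc.
have muO_fin i : (mu (Om i) < +oo)%E by exact: le_lt_trans (muO i) (ltry _).
have muO0 i : (0 <= mu (Om i))%E by exact: measure_ge0.
have fineO i : (fine (mu (Om i)))%:E = mu (Om i) by rewrite fineK// ge0_fin_numE.
pose Q i := plank_unitary (P i).
have [N HN] : exists N, forall z, sqnorm z <= rho ->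
    exists2 i, (pickle i < N)%N & disc (complex.Re (section_coord (Q i) z))
      (complex.Im (section_coord (Q i) z)) N.+1%:R^-1 `<=` Om i.
  apply: uniform_disc_cover => [i|z zr]; first by have [] := HO i.
  have zr2 : sqnorm z < r ^+ 2 by exact: le_lt_trans rho_lt.
  have [i _ /plank_setP Kz] := hcover z (complex_ballP r0 zr2).
  exists i; have [_ _ + _ _] := HO i; apply; split.
    by rewrite /plane_of/=; case: (section_coord _ _) Kz.
  rewrite /disc/= !sub0r !sqrrN; apply: le_lt_trans zr2.
  exact: (sqmod_section_coord_le z (plank_unitaryP (P i))).
(* The indices with code below [N]; numbers that code no index are skipped and contribute nothing to
   the sums. *)
pose J := pmap (@pickle_inv I) (iota 0 N).
have uJ : uniq J by apply: (pmap_uniq (@pickle_invK I)); exact: iota_uniq.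
have inJ i : (pickle i < N)%N -> i \in J.
  move=> iN; rewrite mem_pmap; apply/mapP; exists (pickle i); last by rewrite pickleK_inv.
  by rewrite mem_iota.
have sumJ : \sum_(i <- J) fine (mu (Om i)) < A.
  apply: (@le_lt_trans _ _ (s + gap)); last by rewrite /A; lra.
  apply: (@le_trans _ _ (\sum_(i <- J) (fine (cross_section_area (P i)) + gap / 2 ^+ (pickle i).+1))).
    apply: ler_sum => i _; rewrite -lee_fin fineO EFinD area_fineK.
    by have [] := HO i.
  rewrite big_split/=; apply: lerD; first exact: area_le.
  rewrite big_pmap; apply: le_trans (geometric_sum_le N (ltW gap0)).
  apply: ler_sum => k _; case E : (pickle_inv k) => [i|] /=.
    by have := @pickle_invK I k; rewrite E /= => ->.
  by rewrite divr_ge0 ?exprn_ge0// ltW.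
have [|e e0 He] := @smoothed_mass_ge R th N.+1%:R^-1 (ltW th0) th1; first by [].
(* The error constant is uniform in [i] because every [Om i] has area at most [pi * r ^+ 2]; the
   bound [e / 8] on squared steps is the one under which [lap4_potential] holds. *)
have [|||||||||||z zr Hz] := @exists_small_density R n I J Q (fun i => potential mu (Om i) e)
  (fun i => smoothed_mass mu (Om i) e) (fun i => fine (mu (Om i)))
  (2 + 2 * `|r ^+ 2| + e) (32 / e ^+ 2 * (pi * r ^+ 2)) (e / 8) A rho.
- by move=> i; exact: plank_unitaryP.
- by move=> i; rewrite fine_ge0.
- have := normr_ge0 (r ^+ 2); lra.
- by rewrite mulr_ge0 ?(ltW pir0)// divr_ge0// exprn_ge0// ltW.
- by rewrite divr_gt0.
- exact: rho0.
- move=> i; have [cre cim] := continuous_section_coord (Q i).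
  exact: (continuous_potential (mO i) (muO_fin i) (OW i) e0 cre cim).
- by move=> i x y; exact: (potential_le (mO i) (muO_fin i) (OW i) e0).
- move=> i x y p q pq.
  have hpq : 8 * (p ^+ 2 + q ^+ 2) <= e by move: pq; rewrite ler_pdivlMr// mulrC.
  apply: le_trans (lap4_potential (mO i) (muO_fin i) (OW i) e0 x y hpq).
  rewrite lerD2l lerN2 ler_wpM2r ?sqr_ge0// ler_wpM2l//.
    by rewrite divr_ge0// exprn_ge0// ltW.
  by rewrite -lee_fin fineO.
- by move=> i x y; exact: smoothed_mass_ge0.
- exact: sumJ.
(* A whole disc around the section coordinate of [z] lies in some [Om i], so the smoothed mass there
   is at least [pi * th], which exceeds the bound [A / rho] found at [z]. *)
have [i iN dO] := HN z zr.
have := He _ _ _ (mO i) (muO_fin i) dO; have := Hz i (inJ i iN).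
move=> h1 h2; have := lt_le_trans A_lt h2.
by rewrite ltNge h1.
Qed.
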